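(* Let $\mu\in\mathcal{P}(\mathbb{R}^d)$ and $\alpha>0$. If $\frac{1}{\alpha}\le\overline{\dim}_{\mathrm{H}}\,\mu$, then $$f_{\mu}(\alpha)=\frac{1}{\alpha}.$$
   Context: $\mathcal{P}(\mathbb{R}^d)$ is the set of compactly supported Borel probability measures on $\mathbb{R}^d$; $\operatorname{spt}\mu$ is the support of $\mu$; $B(x,r)$ is the open ball with centre $x$ and radius $r$; $\dim_{\mathrm{H}}$ of a set is its Hausdorff dimension. Lower local dimension: $\underline{\dim}_{\mathrm{loc}}\,\mu(x):=\liminf_{r\to 0}\frac{\log\mu(B(x,r))}{\log r}$. Upper Hausdorff dimension of $\mu$: $\overline{\dim}_{\mathrm{H}}\,\mu:=\operatorname{ess\,sup}_{x\sim\mu}\underline{\dim}_{\mathrm{loc}}\,\mu(x)$. Random covering sets: let $\Omega:=(\operatorname{spt}\mu)^{\mathbb{N}}$ with the product probability measure $\mathbb{P}:=\mu^{\mathbb{N}}$. For $\alpha>0$ and $\omega=(\omega_k)_{k\ge1}\in\Omega$ put $E_{\alpha}(\omega):=\limsup_{k\to\infty}B(\omega_k,k^{-\alpha})=\bigcap_{k=1}^\infty\bigcup_{n=k}^\infty B(\omega_n,n^{-\alpha})$. By Kolmogorov's zero-one law, $\dim_{\mathrm{H}}E_{\alpha}(\omega)$ is constant for $\mathbb{P}$-almost every $\omega$, and $f_\mu(\alpha)$ denotes this almost sure value. *)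

(* Defs.v *)
From HB Require Import structures.
From mathcomp Require Import all_boot all_order all_algebra.
From mathcomp Require Import all_classical all_reals all_analysis ess_sup_inf.

Set Implicit Arguments.
Unset Strict Implicit.
Unset Printing Implicit Defensive.

Import Order.TTheory GRing.Theory Num.Theory.
Import numFieldNormedType.Exports.

Local Open Scope classical_set_scope.
Local Open Scope ring_scope.

(* ['rV[R]_d] with its Borel sigma-algebra. *)
Notation borelRV R d := (g_sigma_algebraType (@open 'rV[R]_d)).

Section euclidean.
Context {R : realType} {d : nat}.
Implicit Types (x y : 'rV[R]_d) (r s delta : R) (A U : set 'rV[R]_d).

(* The library norm on ['rV[R]_d] is the sup norm, hence the Euclidean
   versions below; both norms induce the same topology. *)
Definition enorm x : R := Num.sqrt (\sum_(i < d) x ord0 i ^+ 2).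

Definition eball x r : set 'rV[R]_d := [set y | enorm (y - x) < r].

Local Open Scope ereal_scope.

(* [-oo] if [U] is empty *)
Definition ediam U : \bar R :=
  ereal_sup [set (enorm (p.1 - p.2))%:E | p in U `*` U].

(* [diam(U)^s] with the conventions that the empty set contributes [0] and
   that [0^0 = 1], so that [hausdorff_measure 0] is the counting measure. *)
Definition hausdorff_gauge s U : \bar R :=
  if U == set0 then 0 else ediam U `^ s.

Definition hausdorff_premeasure s delta A : \bar R :=
  ereal_inf [set \sum_(i <oo) hausdorff_gauge s (U i) |
    U in [set U : nat -> set 'rV[R]_d |
      A `<=` \bigcup_i U i /\ forall i, ediam (U i) <= delta%:E]].

Definition hausdorff_measure s A : \bar R :=
  ereal_sup [set hausdorff_premeasure s delta A | delta in [set e : R | (0 < e)%R]].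

Definition hausdorff_dim A : \bar R :=
  ereal_inf [set s%:E | s in [set s : R | (0 <= s)%R /\ hausdorff_measure s A = 0]].

Lemma continuous_enorm x : continuous (fun y => enorm (y - x)).
Proof.
move=> y; apply: (@continuous_comp _ _ _
  (fun y : 'rV[R]_d => (\sum_(i < d) (y - x) ord0 i ^+ 2)%R) Num.sqrt);
  last exact: sqrt_continuous.
apply: (@continuous_big R _ +%R 0%R xpredT _ _ (index_enum 'I_d)
  (fun i (y : 'rV[R]_d) => (y - x) ord0 i ^+ 2)%R _) => [|i _ {}y].
  by move=> z; exact: add_continuous.
apply: (@continuous_comp _ _ _
  (fun y : 'rV[R]_d => (y - x)%R ord0 i) (fun t : R => t ^+ 2)%R);
  last exact: exprn_continuous.
apply: (@continuous_comp _ _ _ (fun y : 'rV[R]_d => y - x)%R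
  (fun y : 'rV[R]_d => y ord0 i)); last exact: coord_continuous.
exact: (cvgB cvg_id (cvg_cst _)).
Qed.

Lemma eball_open x r : open (eball x r).
Proof.
by apply: (open_comp (D := [set t : R | (t < r)%R])) => // y _;
  exact: continuous_enorm.
Qed.

Lemma eball_center x r : (0 < r)%R -> eball x r x.
Proof.
move=> r0; rewrite /eball /= /enorm subrr big1 ?sqrtr0// => i _.
by rewrite mxE expr0n.
Qed.

End euclidean.

Section measure_dim.
Context {R : realType} {d : nat}.
Variable mu : probability (borelRV R d) R.
Local Open Scope ereal_scope.

Definition spt : set 'rV[R]_d :=
  [set x | forall r : R, (0 < r)%R -> 0 < mu (eball x r)].

(* [lne 0 = -oo], so the value is [+oo] outside the support. *)
Definition lower_local_dim (x : 'rV[R]_d) : \bar R :=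
  limf_einf (fun r : R => lne (mu (eball x r)) / (ln r)%:E) 0^'+.

Definition upper_hausdorff_dim : \bar R := ess_sup mu lower_local_dim.

Lemma spt_nonempty : spt !=set0.
Proof.
apply/set0P/negP => /eqP spt0.
have null_ball (x : 'rV[R]_d) : exists r : R, (0 < r)%R /\ mu (eball x r) = 0.
  apply/not_existsP => h.
  suff : spt x by rewrite spt0.
  move=> r r0; rewrite lt0e measure_ge0 andbT.
  by apply/eqP => e; exact: (h r).
have [r rP] := choice null_ball.
pose K (n : nat) : set 'rV[R]_d := [set v | `|v| <= n%:R]%R.
have K_null n : mu.-negligible (K n : set (borelRV R d)).
  have : compact (K n).
    apply: bounded_closed_compact.
      by exists n%:R; split => // M nM v /= /le_trans; apply; exact: ltW.
    rewrite (_ : K n = Num.norm @^-1` [set t : R | t <= n%:R]%R)//.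
    by apply: preimage_closed => [v _|]; [exact: norm_continuous|exact: closed_le].
  rewrite compact_cover => /(_ _ setT (fun x => eball x (r x))).
  case=> [x _|x _|F _ KF]; first exact: eball_open.
    by exists x => //; apply: eball_center; have [] := rP x.
  apply: (@negligibleS _ (borelRV R d) R mu _ _ KF); rewrite /cover bigcup_fset.
  elim/big_ind: _ => [|A B|x _].
  - exact: negligible_set0.
  - exact: negligibleU.
  - exists (eball x (r x)); split => //; last by have [] := rP x.
    by apply: sub_sigma_algebra; exact: eball_open.
have : mu.-negligible (\bigcup_n K n : set (borelRV R d)).
  exact: negligible_bigcup.
have -> : \bigcup_n K n = setT.
  rewrite -subTset => v _; exists (Num.truncn `|v|).+1 => //.
  by rewrite /K /= ltW// truncnS_gt.
move=> /measure_negligible -/(_ measurableT).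
move=> mu0; have := probability_setT mu.
by rewrite mu0 => /eqP; rewrite eq_sym onee_eq0.
Qed.

End measure_dim.

Section covering_sets.
Context {R : realType} {d : nat}.
Variable mu : probability (borelRV R d) R.

Definition Omega : Type := nat -> spt mu.

Definition Omega_coord (k : nat) (w : Omega) : 'rV[R]_d := val (w k).

Definition Omega_point : Omega :=
  fun=> SigSub (mem_set (svalP (cid (spt_nonempty mu)))).

HB.instance Definition _ := Choice.copy Omega (nat -> spt mu).
HB.instance Definition _ := isPointed.Build Omega Omega_point.

Definition coord_cylinders : set (set Omega) :=
  \bigcup_k preimage_set_system setT (Omega_coord k) (@measurable _ (borelRV R d)).

(* [Omega] with the product sigma-algebra. *)
Notation Omega_space := (g_sigma_algebraType coord_cylinders).

(* By uniqueness of measures agreeing on a generating pi-system, this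
   characterizes the product measure [mu^N] on [Omega]. *)
Definition is_product_measure (P : probability Omega_space R) : Prop :=
  forall (n : nat) (A : nat -> set (borelRV R d)),
    (forall i, measurable (A i)) ->
    P [set w | forall i, (i < n)%N -> A i (Omega_coord i w)] =
      (\prod_(i < n) mu (A i))%E.

(* Coordinates are indexed from [0], so the [k]-th ball has radius
   [(k + 1)^(- alpha)]. *)
Definition covering_set (alpha : R) (w : Omega) : set 'rV[R]_d :=
  lim_sup_set (fun k => eball (Omega_coord k w) (k.+1%:R `^ (- alpha))).

End covering_sets.

Notation Omega_space mu := (g_sigma_algebraType (@coord_cylinders _ _ mu)).

(* Main.v *)
Require Import Defs.
From mathcomp Require Import all_boot all_order all_algebra.
From mathcomp Require Import all_classical all_reals all_analysis ess_sup_inf.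
From mathcomp Require Import measurable_realfun zify ring lra.

Set Implicit Arguments.
Unset Strict Implicit.
Unset Printing Implicit Defensive.

Import Order.TTheory GRing.Theory Num.Theory.
Import numFieldNormedType.Exports.
Local Open Scope classical_set_scope.
Local Open Scope ring_scope.

(** Write s = 1 / alpha.  The upper bound is the convergence of the tails of
    sum n^(- alpha s') for s' > s.  For the lower bound fix t < s.  Since s is at
    most the upper Hausdorff dimension, there is a set of positive measure on
    which dyadic cubes Q of side 2^-i satisfy mu(Q) <= C 2^(- i t2), t < t2, so mu
    restricted to it has finite discrete t-energy
    sum_i 2^(i t) sum_Q eta(Q)^2.  Starting from it, one builds set functions
    eta_n of bounded energy and mass bounded below, carried by nested compact sets
    K_n whose intersection lies in the covering set.

    To pass from eta to the next stage, almost every point x is attached to the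
    first level j >= j0 such that i |-> 2^(i t1) mu(Q_i(x)) is maximal at j among
    i >= j (t < t1 < t2); such levels exist because this sequence tends to 0.  The
    random points of block j (about 2^(j t1) of them) hitting a cube Q of level j
    are used to keep eta on the part of Q attached to level j, each with weight
    1 / (N_j mu(Q)), so that the mean of the new set function is eta
    up to a small loss of mass.  Maximality of the level bounds the energy of each
    piece and makes the expected energy of the deviation from the mean
    O(2^(j0 (t - t1))), so a.s. some stage succeeds.
    The possible outcomes of the stages are countably many, hence almost surely
    every one of them can be continued.  Finally a cover of the intersection of
    the K_n covers some K_n, finitely many of its sets suffice, and
    Cauchy-Schwarz against the energy bounds its t-content from below. *)

(** * Finitely additive set functions and their energy *)

Section finite_contents.
Context {dT} {T : measurableType dT} {R : realType}.
Implicit Types (eta : set T -> R) (E F : set T).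

(* Only finite additivity is required, so that refining a content is a finite
   weighted sum and no integral is needed. *)
Record fcontent eta : Prop := Fcontent {
  fcontent_ge0 : forall E, measurable E -> 0 <= eta E ;
  fcontent_split : forall E F, measurable E -> measurable F ->
    eta E = eta (F `&` E) + eta (E `\` F) }.

Lemma fcontent0 eta : fcontent eta -> eta set0 = 0.
Proof.
move=> fe; have := fcontent_split fe (@measurable0 _ T) (@measurable0 _ T).
by rewrite setI0 setD0 => h; lra.
Qed.

Lemma fcontent_le eta E F : fcontent eta -> measurable E -> measurable F ->
  E `<=` F -> eta E <= eta F.
Proof.
move=> fe mE mF EF; rewrite (fcontent_split fe mF mE) (setIidl EF).
by rewrite lerDl (fcontent_ge0 fe)//; exact: measurableD.
Qed.

Lemma fcontent_restr eta S : fcontent eta -> measurable S ->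
  fcontent (fun E => eta (S `&` E)).
Proof.
move=> fe mS; split => [E mE|E F mE mF].
  by apply: (fcontent_ge0 fe); exact: measurableI.
rewrite (fcontent_split fe (measurableI _ _ mS mE) mF) setICA; congr (_ + _).
by rewrite -setIDA.
Qed.

Lemma fcontent_sum {I : Type} (l : seq I) (c : I -> R) (f : I -> set T -> R) :
  (forall i, 0 <= c i) -> (forall i, fcontent (f i)) ->
  fcontent (fun E => \sum_(i <- l) c i * f i E).
Proof.
move=> c0 ff; split => [E mE|E F mE mF].
  by apply: sumr_ge0 => i _; rewrite mulr_ge0// (fcontent_ge0 (ff i)).
rewrite -big_split/=; apply: eq_bigr => i _.
by rewrite (fcontent_split (ff i) mE mF) mulrDr.
Qed.

Lemma fcontent_fibers {K : choiceType} (g : T -> K) (s : seq K) eta E :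
  fcontent eta -> uniq s -> (forall x, g x \in s) ->
  (forall k, measurable [set x | g x = k]) -> measurable E ->
  eta E = \sum_(k <- s) eta ([set x | g x = k] `&` E).
Proof.
move=> fe us gs mg mE.
have step : forall s', uniq s' -> eta ([set x | g x \in s'] `&` E) =
    \sum_(k <- s') eta ([set x | g x = k] `&` E).
  elim=> [_|k s' ih /= /andP[ks us']].
    rewrite big_nil (_ : _ `&` _ = set0) ?fcontent0//.
    by apply/seteqP; split => x // [] /=.
  have ms : measurable [set x | g x \in k :: s'].
    rewrite (_ : mkset _ = \big[setU/set0]_(j <- k :: s') [set x | g x = j]).
      by apply: bigsetU_measurable => j _; exact: mg.
    rewrite -bigcup_seq; apply/seteqP; split => x /=.
      by move=> h; exists (g x).
    by case=> j js /= ->.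
  rewrite big_cons -ih//.
  rewrite (fcontent_split fe (measurableI _ _ ms mE) (mg k)); congr (eta _ + eta _).
    apply/seteqP; split => x /=; first by move=> [gk [_ Ex]].
    by move=> [gk Ex]; split => //; split => //; rewrite gk mem_head.
  apply/seteqP; split => x /=.
    by move=> [[+ Ex] /eqP gk]; rewrite inE (negPf gk)/= => gs'.
  move=> [gs' Ex]; split; first by rewrite inE gs' orbT.
  by move=> gk; move: ks; rewrite -gk gs'.
rewrite -step//; congr eta; apply/seteqP; split => x //=; by case.
Qed.

Lemma fcontent_subadditive {I : choiceType} (F : I -> set T) (l : seq I) eta :
  fcontent eta -> (forall i, measurable (F i)) ->
  eta (\bigcup_(i in [set` l]) F i) <= \sum_(i <- l) eta (F i).
Proof.
move=> fe mF; elim: l => [|i l ih].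
  by rewrite big_nil set_nil bigcup_set0 fcontent0.
have mU (s : seq I) : measurable (\bigcup_(i in [set` s]) F i).
  by rewrite bigcup_seq; exact: bigsetU_measurable.
rewrite big_cons (fcontent_split fe (mU _) (mF i)) lerD//.
  apply: (fcontent_le fe) => //; first exact: measurableI.
apply: le_trans ih; apply: (fcontent_le fe) => //; first exact: measurableD.
move=> x [[j /=]]; rewrite inE => /orP[/eqP-> //|jl Fx _].
by exists j.
Qed.

End finite_contents.

(** * Energy of a content along a sequence of finite partitions *)

Section energy.
Context {dT} {T : measurableType dT} {R : realType} {K : countType}.
Variables (u : R) (q : nat -> T -> K) (keys : nat -> seq K).

Definition cell i k : set T := [set x | q i x = k].

(** With [u = 2 ^ t] and dyadic keys this is the discrete counterpart of the Riesz t-energy.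
    Truncation at level [L] keeps it a finite sum; a bound uniform in [L] stands for finite
    energy. *)
Definition energy L (eta : set T -> R) : R :=
  \sum_(i < L) u ^+ i * \sum_(k <- keys i) eta (cell i k) ^+ 2.

Hypothesis u0 : 0 <= u.

Lemma energy_le L eta eta' :
  (forall i k, 0 <= eta (cell i k) <= eta' (cell i k)) ->
  energy L eta <= energy L eta'.
Proof.
move=> h; apply: ler_sum => i _; rewrite ler_wpM2l ?exprn_ge0//.
apply: ler_sum => k _; have /andP[h0 h1] := h i k.
by rewrite lerXn2r// nnegrE//; exact: le_trans h1.
Qed.

Lemma energy_mono eta L L' : (L <= L')%N -> energy L eta <= energy L' eta.
Proof.
move=> LL; rewrite /energy -(subnKC LL) big_split_ord/= lerDl.
by apply: sumr_ge0 => i _; rewrite mulr_ge0 ?exprn_ge0// sumr_ge0// => k _; rewrite sqr_ge0.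
Qed.

Lemma energy_perturb L eta eta' (e : R) : 0 < e ->
  energy L eta' <= (1 + e) * energy L eta +
    (1 + e^-1) * energy L (fun E => eta' E - eta E).
Proof.
move=> e0; rewrite /energy !mulr_sumr -big_split/=; apply: ler_sum => i _.
rewrite !(mulrCA _ (u ^+ i)) -mulrDr ler_wpM2l ?exprn_ge0//.
rewrite !mulr_sumr -big_split/=; apply: ler_sum => k _.
set a := eta' _; set b := eta _; rewrite -subr_ge0.
have -> : (1 + e) * b ^+ 2 + (1 + e^-1) * (a - b) ^+ 2 - a ^+ 2 =
    e * (b - e^-1 * (a - b)) ^+ 2.
  by field; rewrite gt_eqF.
by rewrite mulr_ge0 ?sqr_ge0// ltW.
Qed.

End energy.

(** * One stage of the construction *)

Section geometric_sums.
Context {R : realType}.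
Implicit Types (r u : R).

Lemma geometric_sum_le r n : 0 <= r < 1 -> \sum_(i < n) r ^+ i <= (1 - r)^-1.
Proof.
move=> /andP[r0 r1]; have r10 : 0 < 1 - r by rewrite subr_gt0.
rewrite -(ler_pM2l r10) divff ?gt_eqF//.
have := subrX1 r n; have : 0 <= r ^+ n by rewrite exprn_ge0.
by lra.
Qed.

Lemma geometric_sum_ge1_le u n : 1 < u ->
  \sum_(i < n.+1) u ^+ i <= u / (u - 1) * u ^+ n.
Proof.
move=> u1; have u10 : 0 < u - 1 by rewrite subr_gt0.
rewrite -(ler_pM2l u10) -subrX1 exprS.
rewrite (_ : (u - 1) * _ = u * u ^+ n); last by field; rewrite gt_eqF.
by rewrite lerBlDr lerDl ler01.
Qed.

(* The summand is [u ^+ i] up to [j] and decays geometrically after [j]. *)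
Lemma peak_sum_le u u1 j L : 1 < u -> u < u1 ->
  \sum_(i < L) u ^+ i * (if (i <= j)%N then 1 else u1 ^+ j / u1 ^+ i) <=
  (u / (u - 1) + u1 / (u1 - u)) * u ^+ j.
Proof.
move=> u_gt1 uu1; have u0 : 0 < u by lra.
have u10 : 0 < u1 by lra.
set f := fun i : nat => u ^+ i * (if (i <= j)%N then 1 else u1 ^+ j / u1 ^+ i).
have f0 i : 0 <= f i.
  rewrite /f mulr_ge0 ?exprn_ge0 ?ltW//; case: ifP => // _.
  by rewrite divr_gt0 ?exprn_gt0.
change (\sum_(i < L) f i <= (u / (u - 1) + u1 / (u1 - u)) * u ^+ j).
(* The sum is lengthened to [j.+1 + L] terms so that it can be cut after [j] whether or not [L]
   exceeds [j]. *)
apply: (@le_trans _ _ (\sum_(i < j.+1 + L) f i)).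
  by rewrite addnC big_split_ord/= lerDl sumr_ge0.
rewrite big_split_ord/= mulrDl lerD//.
  apply: le_trans (geometric_sum_ge1_le j u_gt1).
  by apply: ler_sum => -[i /= ij] _; rewrite /f -ltnS ij mulr1.
have r1 : 0 <= u / u1 < 1.
  by rewrite divr_ge0 ?ltW//= ltr_pdivrMr// mul1r.
apply: (@le_trans _ _ (\sum_(i < L) u ^+ j * (u / u1) ^+ i)).
  apply: ler_sum => i _; rewrite /f leqNgt ltnS leq_addr/=.
  rewrite (_ : _ * _ = u ^+ j * (u / u1) ^+ i * (u / u1)); last first.
    rewrite !exprD !exprS exprMn exprVn; field.
    by rewrite !expf_neq0 ?gt_eqF.
  have /andP[r10 /ltW r11] := r1.
  by apply: ler_piMr => //; apply: mulr_ge0; apply: exprn_ge0 => //; exact: ltW.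
rewrite -mulr_sumr mulrC (ler_wpM2r (exprn_ge0 _ (ltW u0)))//.
apply: le_trans (geometric_sum_le _ r1) _.
rewrite le_eqVlt; apply/orP; left; apply/eqP; field; rewrite subr_eq0 !gt_eqF//.
Qed.

End geometric_sums.

(** * Attaching points to levels, and the energy of the resulting pieces *)

Section stages.
Context {dT} {T : measurableType dT} {R : realType} {K : countType}.
Variable mu : probability T R.
Variables (u u1 : R) (q : nat -> T -> K) (keys : nat -> seq K) (N : nat -> nat).

Let m (E : set T) : R := fine (mu E).
Local Notation cell := (cell q).
Local Notation energy := (energy u q keys).

Definition good j : set T := [set x | forall i, (j <= i)%N ->
  u1 ^+ i * m (cell i (q i x)) <= u1 ^+ j * m (cell j (q j x))].

Definition first_good j0 j : set T := [set x | [/\ (j0 <= j)%N, good j x &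
  forall i, (j0 <= i < j)%N -> ~ good i x]].

Definition piece j0 (p : nat * K) : set T := first_good j0 p.1 `&` cell p.1 p.2.

(* [0] on null cells, since [0^-1 = 0]. *)
Definition weight (p : nat * K) : R := ((N p.1)%:R * m (cell p.1 p.2))^-1.

(* The refined set function when [l] lists the (level, key) pairs hit by the
   random points of one stage. *)
Definition refine j0 (l : seq (nat * K)) (eta : set T -> R) : set T -> R :=
  fun E => \sum_(p <- l) weight p * eta (piece j0 p `&` E).

(** Disjoint union of the [first_good j0 j] for [j0 <= j < j1]: a point with a good level in this
    range has a first one. *)
Definition selected j0 j1 : set T :=
  [set x | exists2 j, (j0 <= j < j1)%N & good j x].

Hypotheses (ukeys : forall i, uniq (keys i)) (qkeys : forall i x, q i x \in keys i).
Hypothesis mcell : forall i k, measurable (cell i k).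
Hypotheses (u_gt1 : 1 < u) (uu1 : u < u1).

Lemma fcontent_fine : fcontent m.
Proof.
split => [F mF|F G mF mG]; first by rewrite fine_ge0.
have mFG : measurable (F `&` G) by exact: measurableI.
have mFD : measurable (F `\` G) by exact: measurableD.
rewrite /m setIC -fineD ?fin_num_measure//; congr fine.
rewrite -measureU//; first by rewrite setUIDK.
by rewrite setDE setIACA setICr setI0.
Qed.

(** As [K] is countable, the set is a countable union of intersections of two cells, taken over the
    key pairs that satisfy [P]. *)
Lemma measurable_keys2 i j (P : K -> K -> Prop) :
  measurable [set x | P (q i x) (q j x)].
Proof.
rewrite (_ : mkset _ = \bigcup_k \bigcup_k'
    ([set x | P k k'] `&` (cell i k `&` cell j k'))); last first.
  apply/seteqP; split => x /=.
    by move=> Px; exists (q i x) => //; exists (q j x).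
  by move=> [k _ [k' _ [Pk []]]]; rewrite /cell /= => -> ->.
do 2 (apply: countable_bigcupT_measurable => [|?]; first exact: countableP).
apply: measurableI; last exact: measurableI.
set k := (X in P X); set k' := (X in P _ X).
have [Pk|nPk] := pselect (P k k').
  by rewrite (_ : mkset _ = setT)//; apply/seteqP; split.
by rewrite (_ : mkset _ = set0)//; apply/seteqP; split.
Qed.

Lemma measurable_good j : measurable (good j).
Proof.
rewrite (_ : good j = \bigcap_(i in [set i | (j <= i)%N]) [set x |
   u1 ^+ i * m (cell i (q i x)) <= u1 ^+ j * m (cell j (q j x))]); last first.
  by apply/seteqP; split.
apply: bigcap_measurable => [|i _]; first by exists j => /=.
exact: (@measurable_keys2 i j (fun k k' => u1 ^+ i * m (cell i k) <= u1 ^+ j * m (cell j k'))).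
Qed.

Lemma measurable_first_good j0 j : measurable (first_good j0 j).
Proof.
rewrite (_ : first_good j0 j = [set _ | (j0 <= j)%N] `&` (good j `&`
   ~` \bigcup_(i in [set i | (j0 <= i < j)%N]) good i)).
  apply: measurableI.
    by case: (j0 <= j)%N => //=; [rewrite set_true|rewrite set_false].
  apply: measurableI; first exact: measurable_good.
  by apply/measurableC/bigcup_measurable => i _; exact: measurable_good.
apply/seteqP; split => x.
  by move=> [j0j gx ngx]; split => //; split => // -[i ij gi]; exact: (ngx i).
by move=> [j0j [gx ngx]]; split => // i ij gi; apply: ngx; exists i.
Qed.

Lemma measurable_piece j0 p : measurable (piece j0 p).
Proof. by apply: measurableI; [exact: measurable_first_good|exact: mcell]. Qed.

Lemma measurable_selected j0 j1 : measurable (selected j0 j1).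
Proof.
rewrite (_ : selected _ _ = \bigcup_(j in [set j | (j0 <= j < j1)%N]) good j).
  by apply: bigcup_measurable => j _; exact: measurable_good.
by apply/seteqP; split => x [j jj gx]; exists j.
Qed.

Lemma weight_ge0 p : 0 <= weight p.
Proof. by rewrite invr_ge0 mulr_ge0 ?ler0n// fine_ge0. Qed.

Lemma fcontent_refine j0 l eta : fcontent eta -> fcontent (refine j0 l eta).
Proof.
move=> fe; apply: (fcontent_sum l (f := fun p E => eta (piece j0 p `&` E))).
  exact: weight_ge0.
by move=> p; exact/fcontent_restr/measurable_piece.
Qed.

(** Domination by a multiple of [nu] survives a stage. The multiple may grow with [l]; a later stage
    compensates by starting at a deeper level. *)
Lemma refine_le j0 l eta (nu : set T -> R) H : fcontent nu -> 0 <= H ->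
  (forall E, measurable E -> eta E <= H * nu E) ->
  exists2 H', 0 <= H' & forall E, measurable E -> refine j0 l eta E <= H' * nu E.
Proof.
move=> fnu H0 le; exists (\sum_(p <- l) weight p * H).
  by rewrite sumr_ge0// => p _; rewrite mulr_ge0 ?weight_ge0.
move=> E mE; rewrite mulr_suml; apply: ler_sum => p _.
rewrite -mulrA ler_wpM2l ?weight_ge0//.
have mpE : measurable (piece j0 p `&` E).
  by apply: measurableI => //; exact: measurable_piece.
by apply: (le_trans (le _ mpE)); rewrite ler_wpM2l// (fcontent_le fnu).
Qed.

Lemma first_good_sum j0 j1 (eta : set T -> R) E : fcontent eta -> measurable E ->
  (j0 <= j1)%N ->
  \sum_(j0 <= j < j1) eta (first_good j0 j `&` E) = eta (selected j0 j1 `&` E).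
Proof.
move=> fe mE /subnKC <-; elim: (j1 - j0)%N => [|n ih].
  rewrite addn0 big_geq// (_ : _ `&` _ = set0) ?fcontent0//.
  by apply/seteqP; split => // x [[j /andP[/leq_ltn_trans h /h]]]; rewrite ltnn.
rewrite addnS big_nat_recr ?leq_addr//= ih.
have mS := measurable_selected.
rewrite [RHS](fcontent_split fe (measurableI _ _ (mS j0 (j0 + n).+1) mE) (mS j0 (j0 + n)%N)).
congr (eta _ + eta _); apply/seteqP; split => x.
- move=> [[j /andP[jj jn] gx] Ex]; split; first by exists j => //; rewrite jj.
  by split => //; exists j => //; rewrite jj ltnS ltnW.
- by move=> [sx [_ Ex]].
- move=> [[j0j gx ngx] Ex]; split.
    by split => //; exists (j0 + n)%N => //; rewrite j0j ltnSn.
  by move=> [i ij gi]; exact: (ngx i).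
- move=> [[[j jj gx] Ex] ns]; split => //.
  have ? : j = (j0 + n)%N.
    apply/eqP; rewrite eqn_leq -ltnS; case/andP: (jj) => j0j ->/=.
    by rewrite leqNgt; apply/negP => h; apply: ns; exists j => //; rewrite j0j.
  subst j; split => //; first by rewrite leq_addr.
  by move=> i ij gi; apply: ns; exists i.
Qed.

Definition energy_const : R := u / (u - 1) + u1 / (u1 - u).

Lemma energy_const_ge0 : 0 <= energy_const.
Proof.
have ? := lt_trans ltr01 u_gt1; have ? := lt_trans u_gt1 uu1; move: u_gt1 uu1.
by move=> ? ?; apply: addr_ge0; apply: divr_ge0; lra.
Qed.

(** A cell of level [i] meeting the piece meets it in measure at most that of the cell of level [j],
    and for [i > j] maximality of the attached level improves this by the factor
    [u1 ^+ j / u1 ^+ i]. Bounding one factor of each square in this way and summing the other to the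
    total mass leaves the sum of [peak_sum_le]. *)
Lemma energy_piece L j0 p eta H : fcontent eta -> 0 <= H ->
  (forall E, measurable E -> eta E <= H * m E) ->
  energy L (fun E => eta (piece j0 p `&` E)) <=
    H * m (cell p.1 p.2) * energy_const * u ^+ p.1 * eta (piece j0 p).
Proof.
move=> fe H0 le; case: p => j k /=; set S := piece j0 _.
have u0 : 0 < u := lt_trans ltr01 u_gt1.
have u10 : 0 < u1 := lt_trans u0 uu1.
have mS : measurable S by exact: measurable_piece.
have fm := fcontent_fine.
pose g i : R := if (i <= j)%N then 1 else u1 ^+ j / u1 ^+ i.
have cell_bound i k' : eta (S `&` cell i k') <= H * m (cell j k) * g i.
  have [->|/set0P[x [Sx qx]]] := eqVneq (S `&` cell i k') set0.
    rewrite fcontent0// !mulr_ge0 ?(fcontent_ge0 fm)//; rewrite /g.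
    by case: ifP => // _; rewrite divr_ge0// exprn_ge0// ltW.
  apply: (le_trans (le _ (measurableI _ _ mS (mcell i k')))).
  rewrite -mulrA ler_wpM2l// /g; case: ifPn => [ij|].
    rewrite mulr1; apply: (fcontent_le fm) => //; first exact: measurableI.
    by move=> y [[]].
  rewrite -ltnNge => /ltnW ji.
  apply: (@le_trans _ _ (m (cell i k'))).
    by apply: (fcontent_le fm) => //; exact: measurableI.
  case: Sx => -[_ /(_ i ji) + _] /= qk; rewrite qx qk => h.
  by rewrite mulrA ler_pdivlMr ?exprn_gt0// mulrC (mulrC (m _)).
apply: (@le_trans _ _ (\sum_(i < L) u ^+ i * (H * m (cell j k) * g i * eta S))).
  apply: ler_sum => i _; rewrite (ler_wpM2l (exprn_ge0 _ (ltW u0)))//.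
  rewrite (fcontent_fibers fe (ukeys i) (qkeys i) (mcell i) mS) mulr_sumr.
  apply: ler_sum => k' _; rewrite expr2 [X in _ <= _ * eta X]setIC.
  by rewrite ler_wpM2r ?(fcontent_ge0 fe)//; exact: measurableI.
under eq_bigr do rewrite mulrA mulrCA -!mulrA.
rewrite -mulr_sumr -mulr_sumr -!mulrA ler_wpM2l// ler_wpM2l ?(fcontent_ge0 fm)//.
under eq_bigr do rewrite mulrA.
rewrite -mulr_suml mulrA ler_wpM2r ?(fcontent_ge0 fe)//.
exact: peak_sum_le.
Qed.

End stages.

(** * Second moments *)

Section second_moments.
Context {dO} {O : measurableType dO} {R : realType}.
Variable P : probability O R.
Implicit Types (X Y : O -> R).

Definition bounded_rv X :=
  measurable_fun setT X /\ exists M : R, forall w, `|X w| <= M.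

Local Notation Ex X := (\int[P]_w X w).

Lemma bounded_rv_integrable X : bounded_rv X -> P.-integrable setT (EFin \o X).
Proof.
move=> [mX [M XM]]; apply: measurable_bounded_integrable => //.
  by rewrite (le_lt_trans (probability_le1 _ _))// ltry.
by exists M; split; [exact: num_real|move=> M' MM' w _; exact: le_trans (XM w) (ltW MM')].
Qed.

Lemma bounded_rv_cst (a : R) : bounded_rv (fun=> a).
Proof. by split; [exact: measurable_cst|exists `|a|]. Qed.

Lemma bounded_rvD X Y : bounded_rv X -> bounded_rv Y ->
  bounded_rv (fun w => X w + Y w).
Proof.
move=> [mX [M XM]] [mY [M' YM]]; split; first exact: measurable_funD.
by exists (M + M') => w; rewrite (le_trans (ler_normD _ _))// lerD.
Qed.

Lemma bounded_rvM X Y : bounded_rv X -> bounded_rv Y ->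
  bounded_rv (fun w => X w * Y w).
Proof.
move=> [mX [M XM]] [mY [M' YM]]; split; first exact: measurable_funM.
by exists (M * M') => w; rewrite normrM ler_pM.
Qed.

Lemma bounded_rv_sum {I : Type} (l : seq I) (F : I -> O -> R) :
  (forall i, bounded_rv (F i)) -> bounded_rv (fun w => \sum_(i <- l) F i w).
Proof.
move=> bF; elim: l => [|i l ih].
  by under eq_fun do rewrite big_nil; exact: bounded_rv_cst.
by under eq_fun do rewrite big_cons; exact: bounded_rvD.
Qed.

Lemma bounded_rv_indic (A : set O) : measurable A -> bounded_rv (\1_A : O -> R).
Proof.
move=> mA; split; first exact: measurable_indic.
by exists 1 => w; rewrite indicE; case: (_ \in _); rewrite ?normr1// normr0.
Qed.

Lemma expectD X Y : bounded_rv X -> bounded_rv Y ->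
  Ex (fun w => X w + Y w) = Ex X + Ex Y.
Proof. by move=> bX bY; rewrite RintegralD//; exact: bounded_rv_integrable. Qed.

Lemma expectZ (a : R) X : bounded_rv X -> Ex (fun w => a * X w) = a * Ex X.
Proof. by move=> bX; rewrite RintegralZl//; exact: bounded_rv_integrable. Qed.

Lemma expect_cst (a : R) : Ex (fun=> a) = a.
Proof.
by rewrite Rintegral_cst//; have := probability_setT P; rewrite /= => ->; rewrite mulr1.
Qed.

Lemma expect_sum {I : Type} (l : seq I) (F : I -> O -> R) :
  (forall i, bounded_rv (F i)) ->
  Ex (fun w => \sum_(i <- l) F i w) = \sum_(i <- l) Ex (F i).
Proof.
move=> bF; elim: l => [|i l ih].
  by under eq_Rintegral do rewrite big_nil; rewrite expect_cst big_nil.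
under eq_Rintegral do rewrite big_cons.
by rewrite expectD ?big_cons ?ih//; exact: bounded_rv_sum.
Qed.

Lemma expect_indic (A : set O) : measurable A -> Ex (\1_A) = fine (P A).
Proof. by move=> mA; rewrite /Rintegral integral_indic// setIT. Qed.

Lemma le_expect X Y : bounded_rv X -> bounded_rv Y -> (forall w, X w <= Y w) ->
  Ex X <= Ex Y.
Proof. by move=> bX bY XY; apply: le_Rintegral => //; exact: bounded_rv_integrable. Qed.

(** Markov's inequality for each [L], then continuity from below along the increasing events. It
    turns bounds on truncated energies into one on all truncations at once. *)
Lemma markov_sup (Z : nat -> O -> R) (b delta : R) : 0 < delta ->
  (forall L, bounded_rv (Z L)) -> (forall L w, 0 <= Z L w) ->
  (forall L L' w, (L <= L')%N -> Z L w <= Z L' w) ->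
  (forall L, Ex (Z L) <= b) ->
  let A := [set w | exists L, delta < Z L w] in
  measurable A /\ (P A <= (b / delta)%:E)%E.
Proof.
move=> delta0 bZ Z0 Zmono Zb A.
pose F L : set O := [set w | delta < Z L w].
have mF L : measurable (F L).
  rewrite (_ : F L = setT `&` Z L @^-1` `]delta, +oo[).
    by apply: (bZ L).1 => //; exact: measurable_itv.
  by apply/seteqP; split => w; rewrite /F /= in_itv/= andbT => // -[].
have AE : A = \bigcup_L F L by apply/seteqP; split => w [L]; exists L.
have mA : measurable A by rewrite AE; exact: bigcup_measurable.
split => //; have FP L : (P (F L) <= (b / delta)%:E)%E.
  rewrite -[P _]fineK ?fin_num_measure// lee_fin ler_pdivlMr//.
  apply: le_trans (Zb L); rewrite mulrC -expect_indic// -expectZ; last exact: bounded_rv_indic.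
  apply: le_expect => //.
    by apply: bounded_rvM; [exact: bounded_rv_cst|exact: bounded_rv_indic].
  move=> w; rewrite indicE; have [wF|wF] := boolP (w \in F L).
    by rewrite mulr1 ltW//; rewrite inE in wF.
  by rewrite mulr0.
have : (P \o F) x @[x --> \oo] --> P (\bigcup_n F n).
  apply: nondecreasing_cvg_mu => //; first by rewrite -AE.
  move=> n n' nn; apply/subsetPset => w /= /lt_le_trans; apply; exact: Zmono.
rewrite -AE => cvgP; rewrite -(cvg_lim _ cvgP)//.
by apply: lime_le; [apply/cvg_ex; exists (P A)|exact: nearW].
Qed.

(** By induction on [l]: cross terms of the centred variables have mean zero, and each variance is
    at most the second moment. *)
Lemma variance_sum_le {I : eqType} (l : seq I) (X : I -> O -> R) (e : I -> R) :
  uniq l -> (forall i, bounded_rv (X i)) -> (forall i, Ex (X i) = e i) ->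
  (forall i j, i != j -> i \in l -> j \in l -> Ex (fun w => X i w * X j w) = e i * e j) ->
  Ex (fun w => (\sum_(i <- l) (X i w - e i)) ^+ 2) <=
    \sum_(i <- l) Ex (fun w => X i w * X i w).
Proof.
move=> + bX eX; have bY i : bounded_rv (fun w => X i w - e i).
  by apply: bounded_rvD => //; exact: bounded_rv_cst.
have eY i : Ex (fun w => X i w - e i) = 0.
  by rewrite expectD// ?expect_cst ?eX ?subrr//; exact: bounded_rv_cst.
elim: l => [_ _|i l ih /= /andP[il ul] indep].
  by under eq_Rintegral do rewrite big_nil expr0n/=; rewrite expect_cst big_nil.
rewrite big_cons.
pose S w := \sum_(j <- l) (X j w - e j).
have bS : bounded_rv S by exact: bounded_rv_sum.
have -> : Ex (fun w => (\sum_(j <- i :: l) (X j w - e j)) ^+ 2) =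
    Ex (fun w => (X i w - e i) * (X i w - e i)) +
    (2 * \sum_(j <- l) Ex (fun w => (X i w - e i) * (X j w - e j)) +
     Ex (fun w => S w ^+ 2)).
  rewrite -expect_sum; last by move=> j; exact: bounded_rvM.
  rewrite -expectZ; last by apply: bounded_rv_sum => j; exact: bounded_rvM.
  rewrite -expectD; last 2 first.
    by apply: bounded_rvM; [exact: bounded_rv_cst|apply: bounded_rv_sum => j; exact: bounded_rvM].
    by under eq_fun do rewrite expr2; exact: bounded_rvM.
  rewrite -expectD; last 2 first.
    exact: bounded_rvM.
    apply: bounded_rvD.
      by apply: bounded_rvM; [exact: bounded_rv_cst|apply: bounded_rv_sum => j; exact: bounded_rvM].
    by under eq_fun do rewrite expr2; exact: bounded_rvM.
  apply: eq_Rintegral => w _; rewrite big_cons -mulr_sumr -/(S w); ring.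
have cross j : j != i -> j \in l -> Ex (fun w => (X i w - e i) * (X j w - e j)) = 0.
  move=> ji jl.
  (* Grouped so that the middle term has mean zero while the means of the outer two cancel. *)
  have -> : Ex (fun w => (X i w - e i) * (X j w - e j)) =
      Ex (fun w => X i w * X j w + (- e j) * (X i w - e i) + (- e i) * X j w).
    by apply: eq_Rintegral => w _; ring.
  rewrite !expectD//; do ?[apply: bounded_rvD|apply: bounded_rvM] => //; do ?exact: bounded_rv_cst.
  rewrite !expectZ// eY mulr0 addr0 eX indep ?mem_head ?inE ?jl ?orbT// 1?eq_sym//.
  by rewrite mulNr subrr.
rewrite big1_seq ?mulr0 ?add0r; last first.
  by move=> j /andP[_ jl]; apply: cross => //; apply: contraNneq il => <-.
apply: lerD; last first.
  by apply: ih => // j j' jj jl jl'; apply: indep => //; rewrite inE ?jl ?jl' orbT.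
have -> : Ex (fun w => (X i w - e i) * (X i w - e i)) =
    Ex (fun w => X i w * X i w + (- 2 * e i) * X i w + e i ^+ 2).
  by apply: eq_Rintegral => w _; ring.
rewrite !expectD//; do ?[apply: bounded_rvD|apply: bounded_rvM] => //; do ?exact: bounded_rv_cst.
rewrite expectZ// expect_cst eX.
have := sqr_ge0 (e i); rewrite expr2; nra.
Qed.

Lemma bounded_rv_key {K : choiceType} (s : seq K) (g : O -> K) (c : K -> R) :
  uniq s -> (forall w, g w \in s) -> (forall k, measurable [set w | g w = k]) ->
  bounded_rv (fun w => c (g w)) /\
  Ex (fun w => c (g w)) = \sum_(k <- s) c k * fine (P [set w | g w = k]).
Proof.
move=> us gs mg.
have cE w : c (g w) = \sum_(k <- s) c k * \1_[set w | g w = k] w.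
  rewrite (bigD1_seq (g w))//= big1 ?addr0 ?indicE ?mem_set ?mulr1//.
  by move=> k kg; rewrite indicE memNset ?mulr0// => /= gk; rewrite gk eqxx in kg.
have bc k : bounded_rv (fun w => c k * \1_[set w | g w = k] w).
  by apply: bounded_rvM; [exact: bounded_rv_cst|exact: bounded_rv_indic].
have -> : (fun w => c (g w)) = (fun w => \sum_(k <- s) c k * \1_[set w | g w = k] w).
  exact/funext.
split; first exact: bounded_rv_sum.
rewrite expect_sum//; apply: eq_bigr => k _.
by rewrite expectZ ?expect_indic//; exact: bounded_rv_indic.
Qed.

Lemma variance_keys_le {I : eqType} {K : choiceType} (l : seq I) (s : I -> seq K)
    (g : I -> O -> K) (c : I -> K -> R) (p : I -> K -> R) :
  uniq l -> (forall i, uniq (s i)) -> (forall i w, g i w \in s i) ->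
  (forall i k, measurable [set w | g i w = k]) ->
  (forall i k, P [set w | g i w = k] = (p i k)%:E) ->
  (forall i j k k', i != j -> i \in l -> j \in l ->
     P ([set w | g i w = k] `&` [set w | g j w = k']) = (p i k * p j k')%:E) ->
  let D w := \sum_(i <- l) (c i (g i w) - \sum_(k <- s i) c i k * p i k) in
  bounded_rv D /\
  Ex (fun w => D w ^+ 2) <= \sum_(i <- l) \sum_(k <- s i) c i k ^+ 2 * p i k.
Proof.
move=> ul us gs mg Pp indep D.
pose X i w := c i (g i w); pose e i := \sum_(k <- s i) c i k * p i k.
have XP i := bounded_rv_key (c i) (us i) (gs i) (mg i).
have bX i : bounded_rv (X i) by exact: (XP i).1.
have eX i : Ex (X i) = e i.
  by rewrite (XP i).2; apply: eq_bigr => k _; rewrite Pp.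
split.
  by apply: bounded_rv_sum => i; exact: (bounded_rvD (bX i) (bounded_rv_cst _)).
have -> : \sum_(i <- l) \sum_(k <- s i) c i k ^+ 2 * p i k =
    \sum_(i <- l) Ex (fun w => X i w * X i w).
  apply: eq_bigr => i _.
  rewrite (bounded_rv_key (fun k => c i k * c i k) (us i) (gs i) (mg i)).2.
  by apply: eq_bigr => k _; rewrite Pp expr2.
apply: variance_sum_le => // i j ij il jl.
(* The pair of keys is itself a random key, so the same lemma computes the mean of the product. *)
have := @bounded_rv_key (K * K)%type [seq (k, k') | k <- s i, k' <- s j]
  (fun w => (g i w, g j w)) (fun k => c i k.1 * c j k.2).
have pairE k : [set w | (g i w, g j w) = k] = [set w | g i w = k.1] `&` [set w | g j w = k.2].
  by case: k => k k'; apply/seteqP; split => w /= [-> ->].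
case=> [||k|_ ->].
- by apply: allpairs_uniq; [exact: us|exact: us|move=> [? ?] [? ?] _ _ /= ->].
- by move=> w; apply: allpairs_f.
- by rewrite pairE; exact: measurableI.
rewrite big_allpairs /e mulr_suml; apply: eq_bigr => k _.
rewrite mulr_sumr; apply: eq_bigr => k' _.
by rewrite pairE indep//= mulrACA.
Qed.

End second_moments.

(** * Refinement by random points: mean, variance and almost sure success *)

Section random_refinement.
Context {dT} {T : measurableType dT} {R : realType} {K : countType}.
Variable mu : probability T R.
Variables (u u1 v : R) (q : nat -> T -> K) (keys : nat -> seq K) (N : nat -> nat).
Hypotheses (ukeys : forall i, uniq (keys i)) (qkeys : forall i x, q i x \in keys i).
Hypothesis mcell : forall i k, measurable (cell q i k).
Hypotheses (u_gt1 : 1 < u) (uu1 : u < u1) (uv : u < v).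
Hypothesis vN : forall j, v ^+ j <= (N j)%:R.
Variable k0 : K.
Hypothesis q0 : forall x, q 0 x = k0. 
Hypothesis k0keys : k0 \in keys 0.
Context {dO} {O : measurableType dO}.
Variables (P : probability O R) (W : nat -> nat -> O -> T).
Hypothesis mW : forall j i A, measurable A -> measurable (W j i @^-1` A).
Hypothesis PW : forall j i A, measurable A -> P (W j i @^-1` A) = mu A.
Hypothesis PW2 : forall j i j' i' A B, (j, i) != (j', i') ->
  (i < N j)%N -> (i' < N j')%N -> measurable A -> measurable B ->
  P (W j i @^-1` A `&` W j' i' @^-1` B) = (mu A * mu B)%E.

Let m (E : set T) : R := fine (mu E).
Local Notation cell := (cell q).
Local Notation energy := (energy u q keys).
Local Notation piece := (piece mu u1 q).
Local Notation first_good := (first_good mu u1 q).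
Local Notation selected := (selected mu u1 q).
Local Notation weight := (weight mu q N).
Local Notation refine := (refine mu u1 q N).

Definition block_indices j0 j1 : seq (nat * nat) :=
  [seq (j, i) | j <- index_iota j0 j1, i <- iota 0 (N j)].

(** Only the keys of the random points are recorded, not the points, so that the outcomes form a
    countable type. *)
Definition observation j0 j1 w : seq (nat * K) :=
  [seq (p.1, q p.1 (W p.1 p.2 w)) | p <- block_indices j0 j1].

Let u0 : 0 < u := lt_trans ltr01 u_gt1.
Let v0 : 0 < v := lt_trans u0 uv.
Let uv_ge0 : 0 <= u / v. Proof. by rewrite divr_ge0// ltW. Qed.
Let uv_lt1 : u / v < 1. Proof. by rewrite ltr_pdivrMr// mul1r. Qed.

Lemma block_size_gt0 j : 0 < (N j)%:R :> R.
Proof. exact: lt_le_trans (exprn_gt0 _ v0) (vN j). Qed.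

Lemma big_block_indices j0 j1 (F : nat -> R) :
  \sum_(p <- block_indices j0 j1) (N p.1)%:R^-1 * F p.1 = \sum_(j0 <= j < j1) F j.
Proof.
rewrite big_allpairs_dep; apply: eq_bigr => j _ /=.
rewrite big_const_seq iter_addr_0 count_predT size_iota -[LHS]mulr_natr.
by rewrite mulrAC mulVf ?mul1r// gt_eqF ?block_size_gt0.
Qed.

Section fixed_content.
Variables (eta : set T -> R) (H : R).
Hypotheses (fe : fcontent eta) (H0 : 0 <= H).
Hypothesis etaH : forall E, measurable E -> eta E <= H * m E.

Let mp j0 p : measurable (piece j0 p).
Proof. exact: measurable_piece. Qed.

Lemma null_piece j0 j k E : m (cell j k) = 0 -> measurable E ->
  eta (piece j0 (j, k) `&` E) = 0.
Proof.
move=> m0 mE; apply/eqP; rewrite eq_le (fcontent_ge0 fe) ?andbT; last exact: measurableI.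
apply: (le_trans (y := eta (cell j k))).
  apply: (fcontent_le fe) => //; first exact: measurableI.
  by move=> x [[]].
by rewrite (le_trans (etaH (mcell j k)))// m0 mulr0.
Qed.

Lemma first_good_keys j0 j E : measurable E ->
  \sum_(k <- keys j) eta (piece j0 (j, k) `&` E) = eta (first_good j0 j `&` E).
Proof.
move=> mE; have mF : measurable (first_good j0 j `&` E).
  by apply: measurableI => //; exact: measurable_first_good.
rewrite (fcontent_fibers fe (ukeys j) (qkeys j) (mcell j) mF).
by apply: eq_bigr => k _; rewrite setIA [cell j k `&` _]setIC.
Qed.

(* [eta (selected j0 j1 `&` E)] is the mean of the refined content at [E]. *)
Definition deviation j0 j1 w E :=
  refine j0 (observation j0 j1 w) eta E - eta (selected j0 j1 `&` E).

Let coef j0 E (p : nat * nat) k := weight (p.1, k) * eta (piece j0 (p.1, k) `&` E).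

(** A sum of centred variables, one per random point: in the mean, the cell measure inside the
    weight cancels against the probability of hitting the cell. On null cells the weight is zero,
    but so is the content of the piece, by domination. *)
Lemma deviationE j0 j1 w E : measurable E -> (j0 <= j1)%N ->
  deviation j0 j1 w E = \sum_(p <- block_indices j0 j1)
    (coef j0 E p (q p.1 (W p.1 p.2 w)) -
     \sum_(k <- keys p.1) coef j0 E p k * m (cell p.1 k)).
Proof.
move=> mE j01; rewrite big_split/= sumrN /deviation /refine big_map; congr (_ - _).
rewrite -(first_good_sum mu u1 mcell fe mE j01) -big_block_indices.
apply: eq_bigr => -[j i] _ /=; rewrite -first_good_keys// mulr_sumr.
apply: eq_bigr => k _; rewrite /coef /weight/= -/m.
have [m0|m0] := eqVneq (m (cell j k)) 0.
  by rewrite null_piece// !mulr0 mul0r.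
rewrite mulrAC invfM -[_^-1 * _ * _]mulrA mulVf ?mulr1//.
Qed.

(** The variance bound for pairwise independent keys. One factor of the squared weight cancels
    against the hitting probability and leaves [N_j^-1] times the weight. *)
Lemma deviation_moment j0 j1 E : measurable E -> (j0 <= j1)%N ->
  bounded_rv (fun w => deviation j0 j1 w E) /\
  \int[P]_w (deviation j0 j1 w E ^+ 2) <=
  \sum_(p <- block_indices j0 j1) \sum_(k <- keys p.1)
    (N p.1)%:R^-1 * weight (p.1, k) * eta (piece j0 (p.1, k) `&` E) ^+ 2.
Proof.
move=> mE j01.
have mV (p : nat * nat) k : measurable [set w | q p.1 (W p.1 p.2 w) = k].
  exact: (mW p.1 p.2 (mcell p.1 k)).
have mE' k j : mu (cell j k) = (m (cell j k))%:E by rewrite fineK// fin_num_measure.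
have := @variance_keys_le _ _ _ P (nat * nat)%type K (block_indices j0 j1)
  (fun p => keys p.1) (fun p w => q p.1 (W p.1 p.2 w)) (coef j0 E)
  (fun p k => m (cell p.1 k)).
case=> [|//|//|//|p k|p p' k k' pp' pl pl'|bD DE].
- apply: allpairs_uniq_dep; [exact: iota_uniq|by move=> *; exact: iota_uniq|].
  by move=> [? ?] [? ?] _ _ /= [-> ->].
- by rewrite (PW p.1 p.2 (mcell p.1 k)).
- rewrite (PW2 (A := cell p.1 k) (B := cell p'.1 k'))//; last 2 first.
  + by case/allpairsPdep: pl => j [i [_ + ->]]; rewrite mem_iota.
  + by case/allpairsPdep: pl' => j [i [_ + ->]]; rewrite mem_iota.
  by rewrite !mE' EFinM.
have -> : (fun w => deviation j0 j1 w E) = fun w => \sum_(p <- block_indices j0 j1)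
    (coef j0 E p (q p.1 (W p.1 p.2 w)) -
     \sum_(k <- keys p.1) coef j0 E p k * m (cell p.1 k)).
  by apply/funext => w; exact: deviationE.
split => //; under eq_Rintegral do rewrite deviationE//.
apply: (le_trans DE); apply: ler_sum => p _; apply: ler_sum => k _.
rewrite /coef exprMn mulrAC ler_wpM2r ?sqr_ge0//.
have [m0|m0] := eqVneq (m (cell p.1 k)) 0.
  rewrite m0 mulr0; apply: mulr_ge0; last exact: weight_ge0.
  by rewrite invr_ge0 ler0n.
by rewrite expr2 {2}/weight/= -/m invfM -mulrA -(mulrA _^-1) mulVf// mulr1 mulrC.
Qed.

(** After exchanging sums, the second moments over all cells assemble into energies of pieces. By
    [energy_piece] the weight cancels the cell measure and leaves two factors [N_j^-1]: one averages
    over the [N_j] points of the block, the other meets [u ^+ j] to give at most [(u / v) ^+ j]. *)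
Lemma energy_deviation L j0 j1 : (j0 <= j1)%N ->
  bounded_rv (fun w => energy L (deviation j0 j1 w)) /\
  \int[P]_w energy L (deviation j0 j1 w) <=
    H * energy_const u u1 * (u / v) ^+ j0 * eta setT.
Proof.
move=> j01.
have bD i k : bounded_rv (fun w => deviation j0 j1 w (cell i k) ^+ 2).
  have [bD _] := deviation_moment (mcell i k) j01.
  by under eq_fun do rewrite expr2; exact: bounded_rvM.
have bS i : bounded_rv (fun w => \sum_(k <- keys i) deviation j0 j1 w (cell i k) ^+ 2).
  exact: bounded_rv_sum.
have bE (i : 'I_L) : bounded_rv (fun w => u ^+ i * \sum_(k <- keys i) deviation j0 j1 w (cell i k) ^+ 2).
  by apply: bounded_rvM => //; exact: bounded_rv_cst.
split; first exact: bounded_rv_sum.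
rewrite expect_sum//.
under eq_bigr do rewrite expectZ// expect_sum//.
set Bd := \sum_(p <- block_indices j0 j1) \sum_(k <- keys p.1)
    (N p.1)%:R^-1 * weight (p.1, k) * energy L (fun E => eta (piece j0 (p.1, k) `&` E)).
apply: (@le_trans _ _ Bd).
  rewrite (_ : Bd = \sum_(i < L) u ^+ i * \sum_(k <- keys i)
      \sum_(p <- block_indices j0 j1) \sum_(k' <- keys p.1)
      (N p.1)%:R^-1 * weight (p.1, k') * eta (piece j0 (p.1, k') `&` cell i k) ^+ 2).
    apply: ler_sum => i _; rewrite (ler_wpM2l (exprn_ge0 _ (ltW u0)))//.
    by apply: ler_sum => k _; have [_] := deviation_moment (mcell i k) j01.
  rewrite /Bd /energy.
  under eq_bigr do under eq_bigr do rewrite mulr_sumr.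
  under eq_bigr do rewrite exchange_big/=.
  rewrite exchange_big/=; apply: eq_bigr => i _.
  under eq_bigr do under eq_bigr do rewrite mulrCA mulr_sumr.
  under eq_bigr do rewrite -mulr_sumr exchange_big/=.
  by rewrite -mulr_sumr exchange_big.
apply: (@le_trans _ _ (\sum_(p <- block_indices j0 j1) (N p.1)%:R^-1 *
    (H * energy_const u u1 * (u / v) ^+ j0 * eta (first_good j0 p.1 `&` setT)))).
  rewrite /Bd big_seq [leRHS]big_seq; apply: ler_sum => p /allpairsPdep[j [i [jj _ ->]]]/=.
  have {}jj : (j0 <= j)%N by move: jj; rewrite mem_index_iota => /andP[].
  rewrite -first_good_keys// !mulr_sumr; apply: ler_sum => k _.
  rewrite -mulrA ler_wpM2l ?invr_ge0 ?ler0n// setIT.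
  have H1 := energy_piece ukeys qkeys mcell u_gt1 uu1 L j0 (j, k) fe H0 etaH.
  apply: (le_trans (ler_wpM2l (weight_ge0 _ _ _ _) H1)).
  have [m0|m0] := eqVneq (m (cell j k)) 0.
    have p0 : eta (piece j0 (j, k)) = 0 by rewrite -[piece _ _]setIT null_piece.
    by rewrite p0 !mulr0.
  rewrite /weight/= -/m invfM.
  rewrite (_ : _ * _ = (N j)%:R^-1 * (H * energy_const u u1 * u ^+ j * eta (piece j0 (j, k)))); last first.
    by field; rewrite m0 gt_eqF ?block_size_gt0.
  rewrite mulrA ler_wpM2r ?(fcontent_ge0 fe)// mulrCA ler_wpM2l ?mulr_ge0 ?energy_const_ge0//.
  rewrite mulrC ler_pdivrMr ?block_size_gt0//.
  apply: (@le_trans _ _ ((u / v) ^+ j * v ^+ j)).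
    by rewrite -exprMn divfK ?gt_eqF.
  apply: ler_pM => //; rewrite ?exprn_ge0//; first exact: ltW.
  by apply: ler_wiXn2l => //; exact: ltW.
rewrite (big_block_indices j0 j1 (fun j => _ * eta (first_good j0 j `&` setT))).
rewrite -mulr_sumr (first_good_sum mu u1 mcell fe measurableT j01).
rewrite ler_wpM2l ?mulr_ge0 ?energy_const_ge0 ?exprn_ge0//.
apply: (fcontent_le fe) => //; apply: measurableI => //; exact: measurable_selected.
Qed.

End fixed_content.

(* The energy bound is strict, so that a small increase is harmless and no
   summation of errors over the stages is needed. *)
Definition energy_mass_ok (B c : R) (eta : set T -> R) :=
  (exists2 b, b < B & forall L, energy L eta <= b) /\ c < eta setT.

(** Level 0 has the whole space as its single cell, so a small energy of the deviation also means a
    small change of mass. *)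
Lemma sqr_setT_le (f : set T -> R) : f setT ^+ 2 <= energy 1 f.
Proof.
have cT : cell 0 k0 = setT by apply/seteqP; split => // x _; exact: q0.
rewrite /energy big_ord1 expr0 mul1r (bigD1_seq k0)//= cT lerDl.
by apply: sumr_ge0 => k _; rewrite sqr_ge0.
Qed.

(** A stage starting at level [n] fails with probability O([(u / v) ^+ n]), by [energy_deviation]
    and [markov_sup]; hence almost surely some stage beyond [J0] succeeds. *)
Lemma refine_ok (nu eta : set T -> R) (H B c : R) : fcontent nu ->
  (forall E, measurable E -> nu E <= m E) ->
  (forall j0 (e : R), 0 < e ->
     exists2 j1, (j0 <= j1)%N & nu (~` selected j0 j1) < e) ->
  fcontent eta -> 0 <= H -> (forall E, measurable E -> eta E <= H * nu E) ->
  energy_mass_ok B c eta -> forall J0,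
  {ae P, forall w, exists j0 j1, (J0 <= j0)%N /\
    energy_mass_ok B c (refine j0 (observation j0 j1 w) eta)}.
Proof.
move=> fnu num sel fe H0 etanu [[b bB Eb] ceta] J0.
have b0 : 0 <= b by have := Eb 0%N; rewrite /energy big_ord0.
have etaH E : measurable E -> eta E <= H * m E.
  by move=> mE; rewrite (le_trans (etanu _ mE))// ler_wpM2l// num.
(* The factor [1 + e] uses at most half of the slack [B - b]. *)
pose e := (B - b) / (2 * (b + 1)).
have e0 : 0 < e by rewrite divr_gt0 ?subr_gt0// mulr_gt0//; lra.
have eb : e * b <= (B - b) / 2.
  have -> : e * b = (B - b) / 2 * (b / (b + 1)).
    by rewrite /e; field; rewrite gt_eqF//; lra.
  rewrite ler_piMr ?divr_ge0 ?subr_ge0 ?(ltW bB)//.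
  by rewrite ler_pdivrMr; lra.
pose g := (eta setT - c) / 2.
have g0 : 0 < g by rewrite divr_gt0// subr_gt0.
have e1 : 0 < 1 + e^-1 by rewrite addr_gt0// invr_gt0.
(* The second entry limits the energy of the deviation to a quarter of the slack; the first limits
   the change of mass to [g]. *)
pose delta := Num.min (g ^+ 2) ((B - b) / 4 / (1 + e^-1)).
have delta0 : 0 < delta.
  by rewrite lt_min exprn_gt0//= divr_gt0// divr_gt0// subr_gt0.
pose b' := (1 + e) * b + (1 + e^-1) * delta.
have b'B : b' < B.
  have : (1 + e^-1) * delta <= (B - b) / 4.
    by rewrite mulrC -ler_pdivlMr// ge_min lexx orbT.
  rewrite /b' mulrDl mul1r; lra.
(* Since [eta <= H * nu], this makes the unselected mass of [eta] less than [g]; the [+ 1] covers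
   [H = 0]. *)
have [j1 j01 nuj1] : {j1 : nat -> nat | forall n, (n <= j1 n)%N &
    forall n, nu (~` selected n (j1 n)) < g / (H + 1)}.
  have /choice[f fP] : forall n, exists j, (n <= j)%N /\ nu (~` selected n j) < g / (H + 1).
    move=> n; have [|j nj] := sel n (g / (H + 1)); first by rewrite divr_gt0//; lra.
    by exists j.
  by exists f => n; have [] := fP n.
pose Z n L w := energy L (deviation eta n (j1 n) w).
pose Bad n := [set w | exists L, delta < Z n L w].
have BadP n : measurable (Bad n) /\
    (P (Bad n) <= (H * energy_const u u1 * (u / v) ^+ n * eta setT / delta)%:E)%E.
  apply: markov_sup => //.
  - by move=> L; exact: (energy_deviation fe H0 etaH L (j01 n)).1.
  - move=> L w; apply: sumr_ge0 => i _; rewrite mulr_ge0 ?(exprn_ge0 _ (ltW u0))//.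
    by rewrite sumr_ge0// => k _; rewrite sqr_ge0.
  - by move=> L L' w LL; apply: energy_mono => //; exact: ltW.
  - by move=> L; exact: (energy_deviation fe H0 etaH L (j01 n)).2.
have mS n := measurable_selected mu u1 mcell n (j1 n).
have good_step n w : ~ Bad n w ->
    energy_mass_ok B c (refine n (observation n (j1 n) w) eta).
  move=> nB; have ZL L : Z n L w <= delta.
    by rewrite leNgt; apply/negP => h; apply: nB; exists L.
  split.
    exists b' => // L.
    apply: (le_trans (energy_perturb _ _ _ L (fun E => eta (selected n (j1 n) `&` E)) _ e0)).
      exact: ltW.
    apply: lerD.
      apply: ler_wpM2l; first by rewrite addr_ge0// ltW.
      apply: le_trans (Eb L); apply: energy_le; first exact: ltW.
      move=> i k; rewrite (fcontent_ge0 fe) ?(fcontent_le fe)//; exact: measurableI.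
    by apply: ler_wpM2l; [exact: ltW|exact: ZL].
  (* Mass balance: the deviation costs at most [g] and the unselected part less than [g], while
     [eta setT] exceeds [c] by [2 * g]. *)
  have : `|deviation eta n (j1 n) w setT| <= g.
    rewrite -(@ler_pXn2r _ 2)// ?nnegrE ?(ltW g0)// real_normK ?num_real//.
    apply: (le_trans (sqr_setT_le _)); apply: (le_trans (ZL 1%N)).
    by rewrite ge_min lexx.
  rewrite ler_norml => /andP[+ _]; rewrite /deviation setIT.
  have := fcontent_split fe measurableT (mS n); rewrite setIT setTD.
  have : eta (~` selected n (j1 n)) < g.
    apply: (le_lt_trans (etanu _ (measurableC (mS n)))).
    have : nu (~` selected n (j1 n)) * (H + 1) < g by rewrite -ltr_pdivlMr//; lra.
    have := fcontent_ge0 fnu (measurableC (mS n)); nra.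
  rewrite /g; lra.
(* The exceptional set lies in every [Bad (J0 + n)], and the probabilities of these tend to 0. *)
exists (\bigcap_n Bad (J0 + n)%N); split.
- by apply: bigcap_measurable => [|n _]; [exists 0%N|exact: (BadP _).1].
- apply/eqP; rewrite eq_le measure_ge0 andbT.
  pose C := H * energy_const u u1 * (u / v) ^+ J0 * eta setT / delta.
  have PC n : (P (\bigcap_n Bad (J0 + n)%N) <= (C * (u / v) ^+ n)%:E)%E.
    apply: le_trans (_ : (P (Bad (J0 + n)%N) <= _)%E).
      apply: le_measure; rewrite ?inE; last by move=> w; apply.
        by apply: bigcap_measurable => [|k _]; [exists 0%N|exact: (BadP _).1].
      exact: (BadP _).1.
    apply: (le_trans (BadP _).2); rewrite lee_fin /C exprD.
    by rewrite le_eqVlt; apply/orP; left; apply/eqP; ring.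
  have cv : (C * (u / v) ^+ n)%:E @[n --> \oo] --> 0%E.
    apply/fine_cvgP; split; first exact: nearW.
    rewrite -(mulr0 C); apply: cvgMr; apply: cvg_expr.
    by rewrite ger0_norm.
  rewrite -(cvg_lim _ cv)//; apply: lime_ge; first by apply/cvg_ex; exists 0%E.
  exact: nearW.
- move=> w /= nok n _; apply: contrapT => nB; apply: nok.
  exists (J0 + n)%N, (j1 (J0 + n)%N); split; first exact: leq_addr.
  exact: good_step.
Qed.

End random_refinement.

(** * The part of the measure with uniform decay on cells: the starting content *)

Section regular_part.
Context {dT} {T : measurableType dT} {R : realType} {K : countType}.
Variable mu : probability T R.
Variables (u1 u2 : R) (q : nat -> T -> K) (keys : nat -> seq K).
Hypotheses (ukeys : forall i, uniq (keys i)) (qkeys : forall i x, q i x \in keys i).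
Hypothesis mcell : forall i k, measurable (cell q i k).
Hypotheses (u10 : 0 < u1) (u12 : u1 < u2).

Let m (E : set T) : R := fine (mu E).

Definition regular_part (C : R) : set T :=
  [set x | forall i, u2 ^+ i * m (cell q i (q i x)) <= C].

Lemma measurable_regular_part C : measurable (regular_part C).
Proof.
rewrite (_ : regular_part C = \bigcap_i [set x | u2 ^+ i * m (cell q i (q i x)) <= C]).
  apply: bigcap_measurable => [|i _]; first by exists 0%N.
  exact: (@measurable_keys2 _ _ _ q mcell i i (fun k _ => u2 ^+ i * m (cell q i k) <= C)).
by apply/seteqP; split => x h i; [move=> _|]; exact: h.
Qed.

(** The sequence [a] is positive and bounded by [C * (u1 / u2) ^+ i], which tends to 0, so it
    attains its maximum over [i >= j0]; a maximiser is a good level. *)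
Lemma good_level C x j0 : regular_part C x ->
  (forall i, 0 < m (cell q i (q i x))) ->
  exists2 j, (j0 <= j)%N & good mu u1 q j x.
Proof.
move=> Cx mx; have u20 : 0 < u2 := lt_trans u10 u12.
pose a i := u1 ^+ i * m (cell q i (q i x)).
have a0 i : 0 < a i by rewrite mulr_gt0 ?exprn_gt0.
have aC i : a i <= C * (u1 / u2) ^+ i.
  have -> : a i = u2 ^+ i * m (cell q i (q i x)) * (u1 / u2) ^+ i.
    by rewrite /a expr_div_n; field; rewrite expf_neq0 ?gt_eqF.
  by rewrite ler_wpM2r ?exprn_ge0 ?divr_ge0// ltW.
have cv : C * (u1 / u2) ^+ n @[n --> \oo] --> (0 : R).
  rewrite -(mulr0 C); apply: cvgMr; apply: cvg_expr.
  by rewrite ger0_norm ?divr_ge0// ?(ltW u10) ?(ltW u20)// ltr_pdivrMr// mul1r.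
have [n _ nP] : \forall n \near \oo, C * (u1 / u2) ^+ n < a j0.
  by apply: (cvgr_lt _ cv); exact: a0.
have an i : (n <= i)%N -> a i < a j0 by move=> /nP; exact: le_lt_trans.
(* From [n] on all values are below [a j0], so a maximiser over [j0 <= i <= maxn n j0] is one over
   all [i >= j0]. *)
pose I := 'I_(maxn n j0).+1; pose i0 : I := Ordinal (leq_maxr n j0 : (j0 < (maxn n j0).+1)%N).
have i0P : (j0 <= i0)%N by [].
case: (@Order.TotalTheory.arg_maxP _ _ I i0 (fun i : I => j0 <= i)%N (fun i : I => a i) i0P) => j j0j jmax.
exists (j : nat) => // i ji.
have [ni|ni] := ltnP (maxn n j0) i; last first.
  have := jmax (Ordinal (ni : (i < (maxn n j0).+1)%N)) => /=; apply.
  exact: leq_trans ji.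
apply: (le_trans (y := a j0)); last exact: (jmax i0 i0P).
apply: ltW; apply: an; apply: leq_trans (ltnW ni); exact: leq_maxl.
Qed.

Lemma null_cells : mu [set x | exists i, m (cell q i (q i x)) = 0] = 0%E.
Proof.
have m0 i k : m (cell q i k) = 0 -> mu (cell q i k) = 0%E.
  by rewrite -[mu _]fineK ?fin_num_measure// /m => ->.
have mZ i : measurable [set x | m (cell q i (q i x)) = 0].
  exact: (@measurable_keys2 _ _ _ q mcell i i (fun k _ => m (cell q i k) = 0)).
have Z i : mu [set x | m (cell q i (q i x)) = 0] = 0%E.
  have fm := fcontent_fine mu.
  rewrite -[mu _]fineK ?fin_num_measure//; congr (_%:E).
  rewrite (fcontent_fibers fm (ukeys i) (qkeys i) (mcell i) (mZ i)).
  rewrite big1// => k _.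
  have [mk|mk] := eqVneq (m (cell q i k)) 0.
    apply/eqP; rewrite eq_le fine_ge0// andbT.
    apply: (@le_trans _ _ (m (cell q i k))); last by rewrite mk.
    apply: (fcontent_le fm); [|exact: mcell|by move=> x []].
    by apply: measurableI => //; exact: mcell.
  rewrite (_ : _ `&` _ = set0) ?measure0//.
  by apply/seteqP; split => // x [/= -> /eqP]; rewrite (negPf mk).
rewrite (_ : mkset _ = \bigcup_i [set x | m (cell q i (q i x)) = 0]).
  apply: measure_negligible; first exact: bigcup_measurable.
  apply: negligible_bigcup => i; apply/negligibleP => //; exact: Z.
by apply/seteqP; split => x [i]; exists i.
Qed.

(** The unselected parts decrease in [j1]. By [good_level] a point in all of them lies in a null
    cell, and such points form a null set; continuity from above concludes. *)
Lemma selected_exhausts C j0 (e : R) : 0 < e ->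
  exists2 j1, (j0 <= j1)%N & m (regular_part C `&` ~` selected mu u1 q j0 j1) < e.
Proof.
move=> e0; pose F n := regular_part C `&` ~` selected mu u1 q j0 n.
have mF n : measurable (F n).
  apply: measurableI; first exact: measurable_regular_part.
  by apply: measurableC; exact: measurable_selected.
have F0 : mu (\bigcap_n F n) = 0%E.
  apply/eqP; rewrite eq_le measure_ge0 andbT -null_cells.
  have mZ : measurable [set x | exists i, m (cell q i (q i x)) = 0].
    rewrite (_ : mkset _ = \bigcup_i [set x | m (cell q i (q i x)) = 0]).
      apply: bigcup_measurable => i _.
      exact: (@measurable_keys2 _ _ _ q mcell i i (fun k _ => m (cell q i k) = 0)).
    by apply/seteqP; split => x [i]; exists i.
  apply: le_measure; rewrite ?inE//; first exact: bigcap_measurable.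
  move=> x Fx; apply: contrapT => /forallNP nZ.
  have [|j j0j gx] := @good_level C x j0 (Fx 0%N I).1.
    by move=> i; rewrite lt_neqAle fine_ge0// andbT eq_sym; exact/eqP/nZ.
  by apply: (Fx j.+1 I).2; exists j => //; rewrite j0j ltnSn.
have : (mu \o F) n @[n --> \oo] --> 0%E.
  rewrite -F0; apply: nonincreasing_cvg_mu => //.
  - by rewrite (le_lt_trans (probability_le1 _ _))// ltry.
  - exact: bigcap_measurable.
  - move=> n n' nn; apply/subsetPset => x [Cx nx]; split => //.
    move=> [j /andP[j0j jn] gx]; apply: nx; exists j => //.
    by rewrite j0j (leq_trans jn).
move=> /fine_cvgP[_ /(cvgr_lt _)/(_ e e0)[n _ nP]].
by exists (maxn n j0); [exact: leq_maxr|apply: nP; exact: leq_maxl].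
Qed.

(** A cell of level [i] meeting the regular part has measure at most [C / u2 ^+ i]. Bounding one
    factor of each square by this gives a geometric series of ratio [u / u2]. *)
Lemma energy_regular_part (u C : R) L : 0 < u -> u < u2 ->
  energy u q keys L (fun E => m (regular_part C `&` E)) <=
    `|C| * (1 - u / u2)^-1.
Proof.
move=> u0 ltuu2; have u20 : 0 < u2 := lt_trans u0 ltuu2.
have fA := fcontent_restr (fcontent_fine mu) (measurable_regular_part C).
have uu2 : 0 <= u / u2 < 1.
  by rewrite divr_ge0 ?(ltW u0) ?(ltW u20)//= ltr_pdivrMr// mul1r.
apply: (@le_trans _ _ (\sum_(i < L) `|C| * (u / u2) ^+ i)); last first.
  by rewrite -mulr_sumr ler_wpM2l//; exact: geometric_sum_le.
apply: ler_sum => i _; rewrite expr_div_n mulrCA ler_wpM2l ?exprn_ge0 ?(ltW u0)//.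
apply: (@le_trans _ _ (\sum_(k <- keys i) `|C| / u2 ^+ i * m (regular_part C `&` cell q i k))).
  apply: ler_sum => k _; rewrite expr2 ler_wpM2r ?fine_ge0//.
  have [->|/set0P[x [Cx qx]]] := eqVneq (regular_part C `&` cell q i k) set0.
    by rewrite /m measure0 mulr_ge0// invr_ge0 exprn_ge0// ltW.
  apply: (@le_trans _ _ (m (cell q i k))).
    apply: (fcontent_le (fcontent_fine mu)) => //.
    by apply: measurableI => //; exact: measurable_regular_part.
  rewrite ler_pdivlMr ?exprn_gt0// mulrC -qx.
  exact: le_trans (Cx i) (ler_norm _).
rewrite -mulr_sumr.
have := fcontent_fibers fA (ukeys i) (qkeys i) (mcell i) measurableT.
under eq_bigr do rewrite setIT.
move=> <-; apply: ler_piMr; first by rewrite mulr_ge0// invr_ge0 exprn_ge0// ltW.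
have mC : measurable (regular_part C `&` setT).
  by apply: measurableI => //; exact: measurable_regular_part.
by rewrite -lee_fin fineK ?fin_num_measure//; exact: probability_le1.
Qed.

End regular_part.

(** * Finite histories of the construction *)

Section codes.
Context {dT} {T : measurableType dT} {R : realType} {K : countType}.
Variable mu : probability T R.
Variables (u u1 : R) (q : nat -> T -> K) (keys : nat -> seq K) (N : nat -> nat).
Variable nu : set T -> R.

(* A code lists the successive pairs (first level, observation), most recent
   first; codes form a countable type. *)
Definition coded_content (c : seq (nat * seq (nat * K))) : set T -> R :=
  foldr (fun s eta => refine mu u1 q N s.1 s.2 eta) nu c.

Hypothesis mcell : forall i k, measurable (cell q i k).
Hypothesis fnu : fcontent nu.

Lemma coded_contentP c : fcontent (coded_content c) /\ exists2 H, 0 <= H &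
  forall E, measurable E -> coded_content c E <= H * nu E.
Proof.
elim: c => [|[j0 l] c [fc [H H0 cH]]] /=.
  by split => //; exists 1 => // E _; rewrite mul1r.
split; first exact: fcontent_refine.
by have [H' H'0 cH'] := refine_le mu u1 N mcell j0 l fnu H0 cH; exists H'.
Qed.

End codes.

Lemma ae_forall_countable {dO} {O : measurableType dO} {R : realType}
    (P : probability O R) {I : countType} (F : I -> O -> Prop) :
  (forall i, {ae P, forall w, F i w}) -> {ae P, forall w, forall i, F i w}.
Proof.
move=> aeF; have : {ae P, forall w, forall n, forall i, unpickle n = Some i -> F i w}.
  apply: ae_foralln => n; case En : (unpickle n) => [i|].
    by apply: filterS (aeF i) => w Fw _ [<-].
  by apply: aeW.
by apply: filterS => w h i; apply: (h (pickle i)); exact: pickleK.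
Qed.

(** * Dyadic cubes *)

Section euclidean_norm.
Context {R : realType} {d : nat}.
Implicit Types x y : 'rV[R]_d.

Lemma coord_le_enorm x i : `|x ord0 i| <= enorm x.
Proof.
rewrite -sqrtr_sqr ler_wsqrtr// (bigD1 i)//= lerDl.
by rewrite sumr_ge0// => j _; rewrite sqr_ge0.
Qed.

(** The constant [d.+1] is a crude substitute for the square root of [d], positive also when
    [d = 0]. *)
Lemma enorm_le x (s : R) : 0 <= s -> (forall i, `|x ord0 i| <= s) ->
  enorm x <= d.+1%:R * s.
Proof.
move=> s0 xs; rewrite -[leRHS]ger0_norm ?mulr_ge0// -sqrtr_sqr ler_wsqrtr//.
apply: (@le_trans _ _ (\sum_(i < d) s ^+ 2)).
  by apply: ler_sum => i _; rewrite -real_normK ?num_real// lerXn2r ?nnegrE.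
rewrite sumr_const card_ord -[leLHS]mulr_natl exprMn ler_wpM2r ?sqr_ge0//.
by rewrite -natrX ler_nat expnS expn1 (leq_trans (leqnSn d))// leq_pmulr.
Qed.

Lemma enorm_coordP x y (s : R) : 0 <= s ->
  (forall i, `|x ord0 i - y ord0 i| <= s) -> enorm (x - y) <= d.+1%:R * s.
Proof. by move=> s0 xy; apply: enorm_le => // i; rewrite !mxE. Qed.

Definition closed_eball x (r : R) : set 'rV[R]_d := [set y | enorm (y - x) <= r].

Lemma closed_closed_eball x r : closed (closed_eball x r).
Proof.
rewrite (_ : closed_eball x r = (fun y => enorm (y - x)) @^-1` [set t | t <= r])//.
by apply: preimage_closed; [move=> y _; exact: continuous_enorm|exact: closed_le].
Qed.

Lemma measurable_coord (i : 'I_d) (B : set R) : measurable B ->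
  measurable ([set x | B (x ord0 i)] : set (borelRV R d)).
Proof.
move=> mB; have : measurable_fun setT (fun x : borelRV R d => (x : 'rV[R]_d) ord0 i).
  apply: (measurability _ (RGenOpens.measurableE R)) => _ [_ [a [b ->] <-]].
  rewrite setTI; apply: sub_sigma_algebra.
  by apply: open_comp => // x _; exact: coord_continuous.
by move=> /(_ measurableT B mB); rewrite setTI.
Qed.

End euclidean_norm.

Section dyadic_keys.
Context {R : realType} {d : nat}.
Variable M : R.
Hypothesis M0 : 0 < M.

(* Position in the interval [[-M, M[] rescaled to [[0, 1[]; points outside are
   sent to [0] so that each level has finitely many keys. *)
Definition rescale (y : R) : R := if - M <= y < M then (y + M) / (2 * M) else 0.

Definition dyadic_key (i : nat) (x : borelRV R d) : {ffun 'I_d -> nat} :=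
  [ffun l => Num.truncn (2 ^+ i * rescale ((x : 'rV[R]_d) ord0 l))].

Definition dyadic_keys (i : nat) : seq {ffun 'I_d -> nat} :=
  [seq [ffun l => f l : nat] | f : {ffun 'I_d -> 'I_(2 ^ i)}].

(* The [3 ^ d] keys at distance at most one in each coordinate (some may be
   repeated because of truncated subtraction). *)
Definition neighbor_keys (k : {ffun 'I_d -> nat}) : seq {ffun 'I_d -> nat} :=
  [seq [ffun l => (k l + f l).-1] | f : {ffun 'I_d -> 'I_3}].

Let M20 : 0 < 2 * M. Proof. by rewrite mulr_gt0. Qed.

Lemma rescale_itv y : 0 <= rescale y < 1.
Proof.
rewrite /rescale; case: ifPn => [/andP[y1 y2]|_]; last by rewrite lexx ltr01.
rewrite divr_ge0 ?(ltW M20)//=; last by rewrite -lerBlDr sub0r.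
by rewrite ltr_pdivrMr// mul1r mulr_natl mulr2n ltrD2r.
Qed.

Lemma scaled_ge0 i y : 0 <= 2 ^+ i * rescale y.
Proof. by rewrite mulr_ge0 ?exprn_ge0//; case/andP: (rescale_itv y). Qed.

Lemma uniq_dyadic_keys i : uniq (dyadic_keys i).
Proof.
rewrite map_inj_uniq ?enum_uniq// => f g /ffunP fg; apply/ffunP => l.
by have := fg l; rewrite !ffunE => /val_inj.
Qed.

Lemma mem_dyadic_keys i x : dyadic_key i x \in dyadic_keys i.
Proof.
have lt l : (Num.truncn (2 ^+ i * rescale (x ord0 l)) < 2 ^ i)%N.
  rewrite truncn_lt_nat ?scaled_ge0// natrX gtr_pMr ?exprn_gt0//.
  by case/andP: (rescale_itv (x ord0 l)).
apply/mapP; exists [ffun l => Ordinal (lt l)]; first by rewrite mem_enum.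
by apply/ffunP => l; rewrite !ffunE.
Qed.

Lemma dyadic_key0 x : dyadic_key 0 x = [ffun=> 0%N].
Proof.
apply/ffunP => l; rewrite !ffunE expr0 mul1r; apply/eqP.
by rewrite eqn0Ngt truncn_gt0 -ltNge; case/andP: (rescale_itv (x ord0 l)).
Qed.

Lemma mem_dyadic_keys0 : [ffun=> 0%N] \in dyadic_keys 0.
Proof. by rewrite -(dyadic_key0 0) mem_dyadic_keys. Qed.

Lemma truncn_close (y z : R) : 0 <= y -> 0 <= z -> y - z < 1 ->
  (Num.truncn y <= (Num.truncn z).+1)%N.
Proof.
move=> y0 z0 yz; rewrite -ltnS truncn_lt_nat// -natr1.
by have /andP[_] := truncn_itv z0; lra.
Qed.

Lemma measurable_rescale : measurable_fun setT rescale.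
Proof.
apply: measurable_fun_ifT => /=.
- apply: (measurable_fun_bool true) => //.
  rewrite (_ : _ @^-1` _ = `[- M, M[%classic); first by rewrite setTI; exact: measurable_itv.
  by apply/seteqP; split => y; rewrite /= in_itv.
- by apply: measurable_funM => //; apply: measurable_funD.
- exact: measurable_cst.
Qed.

Lemma measurable_dyadic_cell i k :
  measurable (cell dyadic_key i k).
Proof.
pose B l : set R := [set y | Num.truncn (2 ^+ i * rescale y) = k l].
have mB l : measurable (B l).
  rewrite (_ : B l = setT `&` (fun y => 2 ^+ i * rescale y) @^-1`
      `[(k l)%:R, (k l).+1%:R[%classic).
    have mf : measurable_fun setT (fun y => 2 ^+ i * rescale y).
      by apply: measurable_funM => //; exact: measurable_rescale.
    by apply: mf => //; exact: measurable_itv.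
  apply/seteqP; split => y; rewrite /B /= in_itv/=.
    by move=> <-; split => //; rewrite truncn_itv// scaled_ge0.
  by move=> [_ h]; apply: truncn_def.
rewrite (_ : cell _ _ _ = \bigcap_(l in [set: 'I_d]) [set x : borelRV R d | B l ((x : 'rV[R]_d) ord0 l)]).
  by apply: fin_bigcap_measurable => [|l _]; [exact: finite_finset|exact: (measurable_coord _ (mB l))].
apply/seteqP; split => x.
  by move=> /ffunP h l _; have := h l; rewrite ffunE.
by move=> h; apply/ffunP => l; rewrite ffunE; exact: h.
Qed.

Definition side i : R := 2 * M / 2 ^+ i.

Lemma side_gt0 i : 0 < side i.
Proof. by rewrite divr_gt0// exprn_gt0. Qed.

Lemma scaled_sub i y z : `|y| < M -> `|z| < M ->
  `|2 ^+ i * rescale y - 2 ^+ i * rescale z| = `|y - z| / side i.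
Proof.
rewrite !ltr_norml /rescale => /andP[/ltW y1 y2] /andP[/ltW z1 z2].
rewrite y1 y2 z1 z2/= (_ : _ - _ = (y - z) / side i).
  by rewrite normrM normfV (gtr0_norm (side_gt0 i)).
by rewrite /side; field; rewrite expf_neq0//= gt_eqF.
Qed.

Lemma same_key_close i (x y : 'rV[R]_d) : (forall l, `|x ord0 l| < M) ->
  (forall l, `|y ord0 l| < M) -> dyadic_key i x = dyadic_key i y ->
  enorm (y - x) <= d.+1%:R * side i.
Proof.
move=> xM yM /ffunP xy; apply: enorm_coordP => [|l]; first exact: ltW (side_gt0 i).
rewrite -[leRHS]mul1r -ler_pdivrMr ?side_gt0// -scaled_sub//.
have := xy l; rewrite !ffunE => h.
have := truncn_itv (scaled_ge0 i (x ord0 l)); have := truncn_itv (scaled_ge0 i (y ord0 l)).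
rewrite h -natr1 => /andP[a1 a2] /andP[b1 b2].
by rewrite ler_norml; lra.
Qed.

Lemma close_neighbor_keys i (x y : 'rV[R]_d) : (forall l, `|x ord0 l| < M) ->
  (forall l, `|y ord0 l| < M) -> enorm (y - x) < side i ->
  dyadic_key i y \in neighbor_keys (dyadic_key i x).
Proof.
move=> xM yM xy.
have close l : (dyadic_key i x l <= (dyadic_key i y l).+1)%N &&
    (dyadic_key i y l <= (dyadic_key i x l).+1)%N.
  have : `|2 ^+ i * rescale (y ord0 l) - 2 ^+ i * rescale (x ord0 l)| < 1.
    rewrite scaled_sub// ltr_pdivrMr ?side_gt0// mul1r.
    by apply: le_lt_trans xy; have := coord_le_enorm (y - x) l; rewrite !mxE.
  rewrite ltr_norml !ffunE => /andP[h1 h2].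
  by apply/andP; split; apply: truncn_close; rewrite ?scaled_ge0//; lra.
(* The digits differ by at most one, so the difference shifted by one is 0, 1 or 2; [neighbor_keys]
   undoes the shift with [.-1]. *)
have f_lt l : ((dyadic_key i y l).+1 - dyadic_key i x l < 3)%N by have := close l; lia.
apply/mapP; exists [ffun l => Ordinal (f_lt l)]; first by rewrite mem_enum.
apply/ffunP => l; rewrite [RHS]ffunE (ffunE (fun l => Ordinal (f_lt l)))/=.
by have := close l; lia.
Qed.

Lemma size_neighbor_keys k : size (neighbor_keys k) = (3 ^ d)%N.
Proof. by rewrite size_map -cardE card_ffun !card_ord. Qed.

End dyadic_keys.

(** * Hausdorff measures *)

Section hausdorff.
Context {R : realType} {d : nat}.
Implicit Types (U A : set 'rV[R]_d) (s t : R).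
Local Open Scope ereal_scope.

Lemma ediam_ge0 U : U !=set0 -> 0 <= ediam U.
Proof.
move=> [x Ux]; apply: ereal_sup_ubound; exists (x, x) => //=.
by rewrite subrr /enorm big1 ?sqrtr0// => i _; rewrite mxE expr0n.
Qed.

Lemma enorm_le_ediam U x y : U x -> U y -> (enorm (x - y))%:E <= ediam U.
Proof. by move=> Ux Uy; apply: ereal_sup_ubound; exists (x, y). Qed.

Lemma hausdorff_gauge_ge0 s U : 0 <= hausdorff_gauge s U.
Proof. by rewrite /hausdorff_gauge; case: ifP => // _; exact: poweR_ge0. Qed.

Lemma ediam_eball_le (x : 'rV[R]_d) (r : R) : (0 <= r)%R ->
  ediam (eball x r) <= (d.+1%:R * (2 * r))%:E.
Proof.
move=> r0; apply: ub_ereal_sup => _ [[y z] [/= yr zr] <-]; rewrite lee_fin.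
apply: enorm_coordP => [|i]; first by rewrite mulr_ge0.
rewrite -[(_ - _)%R](subrKA (x ord0 i)) (le_trans (ler_normD _ _))//.
rewrite mulr_natl mulr2n lerD//.
  by apply: le_trans (ltW yr); have := coord_le_enorm (y - x) i; rewrite !mxE.
by rewrite distrC; apply: le_trans (ltW zr); have := coord_le_enorm (z - x) i; rewrite !mxE.
Qed.

Lemma hausdorff_gauge_le s U (r : R) : (0 <= s)%R -> (0 <= r)%R ->
  ediam U <= r%:E -> hausdorff_gauge s U <= (r `^ s)%:E.
Proof.
move=> s0 r0 Ur; rewrite /hausdorff_gauge; case: ifPn => [_|/set0P U0].
  by rewrite lee_fin powR_ge0.
have := ediam_ge0 U0; move: Ur; case: (ediam U) => [a| |]//=; rewrite !lee_fin => ar a0.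
by apply: ge0_ler_powR => //; rewrite nnegrE//; exact: le_trans ar.
Qed.

Lemma hausdorff_gauge_anti s t U : (0 <= s <= t)%R -> ediam U <= 1 ->
  hausdorff_gauge t U <= hausdorff_gauge s U.
Proof.
move=> /andP[s0 st] U1; rewrite /hausdorff_gauge; case: ifPn => // /set0P U0.
have := ediam_ge0 U0; move: U1; case: (ediam U) => [r| |]//=; rewrite !lee_fin => r1 r0.
have [->|rn0] := eqVneq r 0%R.
  (* Because [0 ^ 0 = 1], diameter zero needs care: [t = 0] forces [s = 0], and otherwise the left
     side vanishes. *)
  have [t0|tn0] := eqVneq t 0%R.
    by rewrite (_ : s = t)//; apply/eqP; rewrite eq_le st t0 s0.
  by rewrite powR0// powR_ge0.
apply: ger_powR => //; by rewrite lt_neqAle eq_sym rn0 r0.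
Qed.

(** The premeasure at scale 1 is already at least [c]: on sets of diameter at most 1, lowering the
    exponent from [t] to [s] can only increase the gauge. *)
Lemma hausdorff_measure_neq0 s t A (c : R) : (0 <= s <= t)%R -> (0 < c)%R ->
  (forall U : nat -> set 'rV[R]_d, A `<=` \bigcup_i U i ->
     (forall i, ediam (U i) <= 1) ->
     c%:E <= \sum_(i <oo) hausdorff_gauge t (U i)) ->
  hausdorff_measure s A != 0.
Proof.
move=> st c0 cover; apply/eqP => sA0.
have : hausdorff_premeasure s 1 A <= 0.
  by rewrite -sA0; apply: ereal_sup_ubound; exists 1%R => //=.
apply/negP; rewrite -ltNge; apply: (@lt_le_trans _ _ c%:E); first by rewrite lte_fin.
apply: le_ereal_inf_tmp => _ [U [AU U1] <-].
apply: (le_trans (cover U AU U1)); apply: lee_nneseries => i _.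
  by rewrite hausdorff_gauge_ge0.
exact: hausdorff_gauge_anti (U1 i).
Qed.

Lemma hausdorff_dim_ge A (a : R) : (forall s, (0 <= s < a)%R ->
  hausdorff_measure s A != 0) -> a%:E <= hausdorff_dim A.
Proof.
move=> h; apply: le_ereal_inf_tmp => _ [s [s0 sA] <-]; rewrite lee_fin leNgt.
by apply/negP => sa; have /eqP := h s ltac:(by rewrite s0 sa).
Qed.

(** Discrete form of the integral comparison: each term is at most a difference of consecutive
    values of [q^-1 * x ^ (- q)], and the differences telescope. *)
Lemma power_tail_le (q : R) k : (0 < q)%R -> forall n,
  (\sum_(k.+1 <= i < k.+1 + n) i.+1%:R `^ (- (1 + q)) <= q^-1 * k.+1%:R `^ (- q) :> R)%R.
Proof.
move=> q0 n.
have step i : (i.+2%:R `^ (- (1 + q)) <=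
    q^-1 * (i.+1%:R `^ (- q) - i.+2%:R `^ (- q)) :> R)%R.
  have i1 : (0 < i.+1%:R :> R)%R by rewrite ltr0n.
  have i2 : (0 < i.+2%:R :> R)%R by rewrite ltr0n.
  have -> : (i.+1%:R `^ (- q) = i.+2%:R `^ (- q) * (i.+2%:R / i.+1%:R) `^ q :> R)%R.
    rewrite powRM ?invr_ge0 ?(ltW i1) ?(ltW i2)// mulrA -powRD; last first.
      by apply/implyP => _; rewrite gt_eqF.
    by rewrite addNr powRr0 mul1r -powR_inv1 ?(ltW i1)// -powRrM mulN1r.
  (* From [1 + x <= exp x], together with [ln (1 + y) <= y] at [y = - 1 / (i + 2)]. *)
  have h : (1 + q / i.+2%:R <= (i.+2%:R / i.+1%:R) `^ q :> R)%R.
    rewrite /powR mulf_eq0 invr_eq0 !gt_eqF//=.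
    apply: le_trans (expR_ge1Dx _); rewrite lerD2l ler_wpM2l ?(ltW q0)//.
    rewrite -[X in ln X]invrK lnV ?posrE ?invr_gt0 ?divr_gt0// lerNr.
    rewrite invf_div.
    have -> : (i.+1%:R / i.+2%:R = 1 + - i.+2%:R^-1 :> R)%R.
      rewrite -[i.+2%:R]natr1; move: i1; move: (i.+1%:R)%R => z z0.
      by field; rewrite gt_eqF// addr_gt0.
    apply: le_ln1Dx; rewrite ltrN2 invf_lt1// ltr1n//.
  rewrite opprD powRD; last by apply/implyP => _; rewrite gt_eqF.
  rewrite powR_inv1 ?(ltW i2)//; move: h (powR_ge0 (i.+2%:R : R) (- q)).
  move: (_ `^ q)%R (_ `^ (- q))%R => h X qh X0.
  rewrite -[X in (_ - X)%R]mulr1 -mulrBr mulrCA mulrC ler_wpM2l//.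
  by rewrite mulrC ler_pdivlMr// mulrC lerBrDl.
apply: (@le_trans _ _ (\sum_(k.+1 <= i < k.+1 + n)
    (q^-1 * (i%:R `^ (- q) - i.+1%:R `^ (- q))))%R).
  rewrite big_nat [leRHS]big_nat; apply: ler_sum => -[//|i] _; exact: step.
rewrite -mulr_sumr ler_wpM2l ?invr_ge0 ?(ltW q0)//.
rewrite (telescope_sumr_eq (fun i => - (i%:R `^ (- q)))%R) ?leq_addr//; last first.
  by move=> i _; rewrite opprK addrC.
by rewrite opprK addrC lerBlDr lerDl powR_ge0.
Qed.

End hausdorff.

(** * Upper bound for the dimension of the limsup set, for every sequence of centres *)

Section limsup_upper_bound.
Context {R : realType} {d : nat}.

Lemma power_small (a e : R) : 0 < a -> 0 < e ->
  exists k, forall i, (k <= i)%N -> i.+1%:R `^ (- a) <= e.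
Proof.
move=> a0 e0; exists (Num.truncn (e^-1 `^ a^-1)) => i ki.
have ei : e^-1 `^ a^-1 <= i.+1%:R.
  by apply: ltW; rewrite -truncn_lt_nat ?powR_ge0// ltnS.
rewrite powRN -[leRHS]invrK lef_pV2 ?posrE ?invr_gt0 ?powR_gt0//.
have -> : e^-1 = (e^-1 `^ a^-1) `^ a.
  by rewrite -powRrM mulVf ?gt_eqF// powRr1// invr_ge0 ltW.
by apply: ge0_ler_powR; rewrite ?nnegrE ?powR_ge0// ltW.
Qed.

(** Any tail of the balls covers the limsup set, and the sum of the t-th powers of the radii
    converges since [alpha * t = 1 + q] with [q > 0]. *)
Lemma hausdorff_limsup_balls (x : nat -> 'rV[R]_d) (alpha t : R) :
  0 < alpha -> alpha^-1 < t ->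
  hausdorff_measure t (lim_sup_set (fun k => eball (x k) (k.+1%:R `^ (- alpha)))) = 0%E.
Proof.
move=> alpha0 t_gt; have ai0 : 0 < alpha^-1 by rewrite invr_gt0.
have t0 : 0 < t := lt_trans ai0 t_gt.
set A := lim_sup_set _; set r := fun k : nat => k.+1%:R `^ (- alpha).
have r0 k : 0 <= r k by exact: powR_ge0.
pose C : R := d.+1%:R * 2; have C0 : 0 < C by rewrite mulr_gt0.
pose q := alpha * t - 1.
have q0 : 0 < q.
  by rewrite subr_gt0 -(mulfV (lt0r_neq0 alpha0)) ltr_pM2l.
have gauge_ge0 U i : (0 <= hausdorff_gauge t ((U : nat -> set 'rV[R]_d) i))%E.
  exact: hausdorff_gauge_ge0.
have pre_ge0 delta : (0 <= hausdorff_premeasure t delta A)%E.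
  by apply: le_ereal_inf_tmp => _ [U _ <-]; apply: nneseries_ge0.
have pre_le delta e : 0 < delta -> 0 < e -> (hausdorff_premeasure t delta A <= e%:E)%E.
  move=> delta0 e0.
  have Ct : 0 < C `^ t by exact: powR_gt0.
  (* [k1] brings the diameters below [delta]; [k2] brings the tail bound, with its factor [C ^ t],
     below [e]. *)
  have [k1 k1P] := power_small alpha0 (divr_gt0 delta0 C0).
  have [k2 k2P] := power_small q0 (divr_gt0 (mulr_gt0 e0 q0) Ct).
  pose k := maxn k1 k2.
  pose U j := eball (x (j + k.+1)%N) (r (j + k.+1)%N).
  have dU j : (ediam (U j) <= (C * r (j + k.+1)%N)%:E)%E.
    by rewrite /C -mulrA; exact: ediam_eball_le.
  apply: (@le_trans _ _ (\sum_(j <oo) hausdorff_gauge t (U j))%E).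
    apply: ereal_inf_lbound; exists U => //; split.
      move=> y /(_ k.+1 I) [j /= kj yj]; exists (j - k.+1)%N => //.
      by rewrite /U subnK.
    move=> j; apply: (le_trans (dU j)); rewrite lee_fin mulrC -ler_pdivlMr//.
    by apply: k1P; rewrite addnS ltnW// ltnS (leq_trans (leq_maxl k1 k2))// leq_addl.
  apply: lime_le; first exact: is_cvg_nneseries.
  apply: nearW => n.
  apply: (@le_trans _ _ (\sum_(0 <= j < n) (C `^ t * (j + k.+1).+1%:R `^ (- (1 + q)))%:E)%E).
    apply: lee_sum => j _.
    apply: (le_trans (hausdorff_gauge_le (ltW t0) _ (dU j))).
      by rewrite mulr_ge0// ltW.
    rewrite lee_fin powRM ?(ltW C0)// -powRrM (_ : - alpha * t = - (1 + q))//.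
    by rewrite /q; ring.
  rewrite sumEFin lee_fin -mulr_sumr.
  have := power_tail_le k q0 n.
  rewrite -{1}[k.+1]add0n big_addn addKn => h.
  rewrite mulrC -ler_pdivlMr//; apply: (le_trans h).
  rewrite mulrC ler_pdivrMr// mulrAC; apply: k2P; exact: leq_maxr.
apply/eqP; rewrite eq_le; apply/andP; split.
  apply: ub_ereal_sup => _ [delta /= delta0 <-].
  by apply/lee_addgt0Pr => e e0; rewrite add0e; exact: pre_le.
apply: (le_trans (pre_ge0 1)); apply: ereal_sup_ubound; exists 1 => //=.
Qed.

Lemma hausdorff_dim_limsup_balls_le (x : nat -> 'rV[R]_d) (alpha : R) : 0 < alpha ->
  (hausdorff_dim (lim_sup_set (fun k => eball (x k) (k.+1%:R `^ (- alpha)))) <=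
   (alpha^-1)%:E)%E.
Proof.
move=> alpha0; have ai0 : 0 < alpha^-1 by rewrite invr_gt0.
apply/lee_addgt0Pr => e e0; apply: ereal_inf_lbound.
exists (alpha^-1 + e) => //; split; first by rewrite addr_ge0// ltW.
by apply: hausdorff_limsup_balls => //; rewrite ltrDl.
Qed.

End limsup_upper_bound.

Lemma sum_undup_le {R : numDomainType} {I : eqType} (s : seq I) (f : I -> R) :
  (forall i, 0 <= f i) -> \sum_(i <- undup s) f i <= \sum_(i <- s) f i.
Proof.
move=> f0; elim: s => [|i s ih] //=; case: ifP => _.
  by rewrite big_cons (le_trans ih)// lerDr.
by rewrite !big_cons lerD2l.
Qed.

Lemma powR2_gt1 {R : realType} (t : R) : 0 < t -> 1 < 2 `^ t.
Proof.
move=> t0; have := @gt0_ltr_powR R t t0 1 2; rewrite powR1; apply; rewrite ?nnegrE//.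
by rewrite ltr1n.
Qed.

(** * From bounded energy on nested compact sets to a lower bound on covers *)

Section content_lower_bound.
Context {R : realType} {d : nat}.
Variables (M t : R).
Hypotheses (M1 : 1 <= M) (t0 : 0 < t).

Let M0 : 0 < M. Proof. exact: lt_le_trans ltr01 M1. Qed.
Let u : R := 2 `^ t.
Let u_gt1 : 1 < u. Proof. exact: powR2_gt1. Qed.
Let u0 : 0 < u. Proof. exact: lt_trans ltr01 u_gt1. Qed.

Local Notation side := (side M).

Lemma side_powR i : (side i / (2 * M)) `^ t = u ^- i.
Proof.
have -> : side i / (2 * M) = 2 ^- i.
  by rewrite /side; field; rewrite expf_neq0//= gt_eqF.
by rewrite -[2 ^- i](@powR_invn _ 2 i)// -powRrM mulrC powRrM powR_invn ?(ltW u0).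
Qed.

Lemma expr_inv_small (a e : R) : 1 < a -> 0 < e ->
  exists n, forall i, (n <= i)%N -> a ^- i < e.
Proof.
move=> a1 e0; have cv : (a^-1) ^+ n @[n --> \oo] --> (0 : R).
  apply: cvg_expr; rewrite ger0_norm ?invr_ge0 ?invf_lt1//; lra.
have [n _ nP] : \forall n \near \oo, (a^-1) ^+ n < e by exact: (cvgr_lt _ cv).
by exists n => i /nP /=; rewrite exprVn.
Qed.

(** For [r = 0] a deep level costs at most [e]. Otherwise take the least [n] with [side n.+1 <= r]:
    then [side n / (2 * M) <= r] as [M >= 1], and [r <= 1 < side 0] settles [n = 0]. *)
Lemma level_of_diameter (r e : R) : 0 <= r <= 1 -> 0 < e ->
  exists n, r < side n /\ u ^- n <= r `^ t + e.
Proof.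
move=> /andP[r0 r1] e0; have [{r1}r_0|rn0] := eqVneq r 0.
  have [n nP] := expr_inv_small u_gt1 e0; exists n; split.
    by rewrite r_0 side_gt0.
  by rewrite (le_trans (ltW (nP n (leqnn _))))// lerDr powR_ge0.
have {rn0}r0 : 0 < r by rewrite lt_neqAle eq_sym rn0.
have M2 : 0 < 2 * M by rewrite mulr_gt0.
have ex : exists n, side n.+1 <= r.
  have [n nP] := @expr_inv_small 2 (r / (2 * M)) ltac:(by rewrite ltr1n) (divr_gt0 r0 M2).
  by exists n; rewrite /side mulrC -ler_pdivlMr// ltW// nP.
case: (ex_minnP ex) => n nr nmin; exists n; split.
  case: n nr nmin => [_ _|n _ nmin].
    by apply: (le_lt_trans r1); rewrite /side expr0 divr1; move: M1; lra.
  by rewrite ltNge; apply/negP => /nmin; rewrite ltnn.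
rewrite -side_powR (le_trans _ (_ : r `^ t <= _)) ?lerDl ?(ltW e0)//.
apply: ge0_ler_powR; rewrite ?nnegrE ?(ltW t0) ?(ltW r0) ?divr_ge0 ?(ltW (side_gt0 _ _)) ?(ltW M2)//.
have : side n = 2 * side n.+1 by rewrite /side exprS; field; rewrite expf_neq0.
move=> ->; rewrite ler_pdivrMr//.
have : r <= M * r by rewrite ler_peMl// ltW.
lra.
Qed.

(** A set meeting [Sigma] lies in a ball about one of its points in [Sigma]; a set missing [Sigma]
    gets any centre there and a level so deep that it costs less than [e]. Centres in [Sigma] make
    [close_neighbor_keys] applicable. *)
Lemma ball_of_cover_set (Sigma U : set 'rV[R]_d) (e : R) : Sigma !=set0 -> 0 < e ->
  (ediam U <= 1)%E -> exists p : 'rV[R]_d * nat, [/\ Sigma p.1,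
    U `&` Sigma `<=` eball p.1 (side p.2) &
    ((u ^- p.2)%:E <= hausdorff_gauge t U + e%:E)%E].
Proof.
move=> [x0 Sx0] e0 U1; have [US0|/set0P[x [Ux Sx]]] := eqVneq (U `&` Sigma) set0.
  have [n nP] := expr_inv_small u_gt1 e0; exists (x0, n); split => //=.
    by rewrite US0.
  apply: (@le_trans _ _ e%:E); first by rewrite lee_fin ltW// nP.
  by rewrite leeDr// hausdorff_gauge_ge0.
have U0 : U !=set0 by exists x.
have /negPf Un0 : U != set0 by apply/set0P.
have := ediam_ge0 U0; move: (U1); rewrite /hausdorff_gauge Un0.
have := @enorm_le_ediam _ _ U; case: (ediam U) => [r| |]//= Ur.
rewrite !lee_fin => r1 r0.
have [|n [rn un]] := @level_of_diameter r e _ e0; first by rewrite r0 r1.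
exists (x, n); split => //= y [Uy _].
by rewrite /eball /=; apply: le_lt_trans rn; rewrite -lee_fin; exact: Ur.
Qed.

Variables (Sigma : set 'rV[R]_d) (K : nat -> set 'rV[R]_d).
Variable eta : nat -> set (borelRV R d) -> R.
Variables (B c : R).
Hypotheses (cSigma : compact Sigma) (Sigma0 : Sigma !=set0).
Hypothesis SigmaM : forall x, Sigma x -> forall l, `|x ord0 l| < M.
Hypotheses (K0 : forall n, K n `<=` Sigma) (clK : forall n, closed (K n)).
Hypothesis decK : forall n, K n.+1 `<=` K n.
Hypothesis feta : forall n, fcontent (eta n).
Hypothesis etaK : forall n, eta n (~` K n) = 0.
Hypotheses (B0 : 0 < B) (c0 : 0 < c).
Hypothesis eta_energy : forall n L, energy u (dyadic_key M) (dyadic_keys (d := d)) L (eta n) <= B.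
Hypothesis eta_mass : forall n, c < eta n setT.

(** The open sets made of [V i] and the complement of [K i] cover [Sigma]. If a finite subcover uses
    indices below [m], a point of [K m] lies in each of the corresponding [K i], hence in some
    [V i]. *)
Lemma nested_subcover (V : nat -> set 'rV[R]_d) : (forall i, open (V i)) ->
  \bigcap_n K n `<=` \bigcup_i V i ->
  exists m, K m `<=` \bigcup_(i in [set` iota 0 m]) V i.
Proof.
move=> oV KV; have decK' n n' : (n <= n')%N -> K n' `<=` K n.
  move=> /subnKC <-; elim: (n' - n)%N => [|k ih]; first by rewrite addn0.
  by rewrite addnS => x /decK /ih.
move: cSigma; rewrite compact_cover => /(_ nat setT (fun i => V i `|` ~` K i)).
case=> [i _|x _|F _ SF].
- by apply: openU => //; exact: closed_openC.
- have [xK|] := pselect ((\bigcap_n K n) x).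
    by have [i _ Vi] := KV _ xK; exists i => //; left.
  by move=> /existsNP[n /not_implyP[_ nK]]; exists n => //; right.
have [m mF] : exists m, forall i, i \in finmap.enum_fset F -> (i < m)%N.
  by exists (\max_(i <- finmap.enum_fset F) i).+1 => i iF; rewrite ltnS leq_bigmax_seq.
exists m => x Kx.
have [i /= /mF im] := SF x (K0 Kx).
case=> [Vx|nK]; first by exists i => //=; rewrite mem_iota.
by exfalso; apply: nK; apply: decK' Kx; exact: ltnW.
Qed.

Lemma sum_cells_le n (l : seq (nat * {ffun 'I_d -> nat})) : uniq l ->
  (forall p, p \in l -> p.2 \in dyadic_keys p.1) ->
  \sum_(p <- l) u ^+ p.1 * eta n (cell (dyadic_key M) p.1 p.2) ^+ 2 <= B.
Proof.
move=> ul kl; pose L := (\max_(p <- l) p.1).+1.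
apply: le_trans (eta_energy n L); rewrite /energy.
pose f p := u ^+ p.1 * eta n (cell (dyadic_key M) p.1 p.2) ^+ 2.
have f0 p : 0 <= f p by rewrite /f mulr_ge0 ?sqr_ge0// exprn_ge0// ltW.
pose l' : seq (nat * {ffun 'I_d -> nat}) :=
  [seq (i, k) | i <- index_iota 0 L, k <- dyadic_keys i].
have -> : \sum_(i < L) u ^+ i * \sum_(k <- dyadic_keys i) eta n (cell (dyadic_key M) i k) ^+ 2 =
    \sum_(p <- l') f p.
  rewrite /l' big_allpairs_dep big_mkord; apply: eq_bigr => i _.
  by rewrite mulr_sumr.
have ul' : uniq l'.
  apply: allpairs_uniq_dep; [exact: iota_uniq|by move=> *; exact: uniq_dyadic_keys|].
  by move=> [? ?] [? ?] _ _ /= [-> ->].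
have sub : {subset l <= l'}.
  move=> [i k] p_l; apply/allpairsPdep; exists i, k; split => //; last exact: (kl _ p_l).
  by rewrite mem_index_iota /= ltnS; exact: (leq_bigmax_seq (F := fst) (i, k)).
change (\sum_(p <- l) f p <= \sum_(p <- l') f p).
rewrite (perm_big [seq x <- l' | x \in l])/=; last first.
  apply: uniq_perm => //; first exact: filter_uniq.
  by move=> p; rewrite mem_filter; case: (boolP (p \in l)) => // /sub ->.
rewrite big_filter [leRHS](bigID (fun x => x \in l))/= lerDl; exact: sumr_ge0.
Qed.

(** Finitely many of the enclosing balls cover some [K m], and each ball meets [Sigma] within
    [3 ^ d] cells of its level. These cells carry the mass of [eta m], which exceeds [c], and the
    energy bound forces their [u ^- i] to sum to at least [c ^+ 2 / B]. *)
Lemma content_lower_bound (U : nat -> set 'rV[R]_d) :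
  \bigcap_n K n `<=` \bigcup_i U i -> (forall i, ediam (U i) <= 1)%E ->
  ((c ^+ 2 / B / (3 ^ d)%:R)%:E <= \sum_(i <oo) hausdorff_gauge t (U i))%E.
Proof.
move=> KU U1; apply/lee_addgt0Pr => e e0.
have e2 i : 0 < e / 2 ^+ i.+1 by rewrite divr_gt0// exprn_gt0.
have /choice[p pP] : forall i, exists p : 'rV[R]_d * nat, [/\ Sigma p.1,
    U i `&` Sigma `<=` eball p.1 (side p.2) &
    ((u ^- p.2)%:E <= hausdorff_gauge t (U i) + (e / 2 ^+ i.+1)%:E)%E].
  by move=> i; exact: ball_of_cover_set.
have [m Km] : exists m, K m `<=` \bigcup_(i in [set` iota 0 m]) eball (p i).1 (side (p i).2).
  apply: nested_subcover => [i|x Kx]; first exact: eball_open.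
  have [i _ Ux] := KU _ Kx; exists i => //.
  by have [_ + _] := pP i; apply; split => //; exact: (K0 (Kx 0%N I)).
pose l0 := [seq ((p i).2, k) | i <- iota 0 m, k <- neighbor_keys (dyadic_key M (p i).2 (p i).1)].
(* The energy counts each listed key once, hence the removal of duplicates and of keys outside the
   list of their level. *)
pose l := [seq x <- undup l0 | x.2 \in dyadic_keys x.1].
have ul : uniq l by rewrite filter_uniq// undup_uniq.
have kl x : x \in l -> x.2 \in dyadic_keys x.1 by rewrite mem_filter => /andP[].
have mK : measurable (~` K m : set (borelRV R d)).
  by apply: sub_sigma_algebra; exact: closed_openC.
pose cellp (x : nat * {ffun 'I_d -> nat}) := cell (dyadic_key M) x.1 x.2.
have mcellp x : measurable (cellp x) by exact: measurable_dyadic_cell.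
have cl : c < \sum_(x <- l) eta m (cellp x).
  apply: (lt_le_trans (eta_mass m)); apply: le_trans (fcontent_subadditive l (feta m) mcellp).
  rewrite (fcontent_split (feta m) measurableT mK) setIT etaK add0r setTD setCK.
  apply: (fcontent_le (feta m)).
  - by rewrite -[K m]setCK; exact: measurableC.
  - by rewrite bigcup_seq; apply: bigsetU_measurable => x _.
  move=> y Ky; have [i /= il yi] := Km y Ky; have [Sx _ _] := pP i.
  suff yl : ((p i).2, dyadic_key M (p i).2 y) \in l.
    by exists ((p i).2, dyadic_key M (p i).2 y).
  rewrite mem_filter mem_dyadic_keys//=.
  have -> := mem_undup l0; apply/allpairsPdep.
  exists i, (dyadic_key M (p i).2 y); split => //.
  by apply: close_neighbor_keys => //; apply: SigmaM => //; exact: K0 Ky.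
(* AM-GM: [2 c h <= B u^-i + (c^2 / B) u^i h^2] for each cell. *)
have lS : c ^+ 2 / B <= \sum_(x <- l) u ^- x.1.
  have := sum_cells_le m ul kl.
  set E2 := \sum_(x <- l) _ => E2B; set S := (X in _ <= X).
  have : c * (\sum_(x <- l) eta m (cellp x)) <= (B * S + c ^+ 2 / B * E2) / 2.
    rewrite !mulr_sumr -big_split/= mulr_suml; apply: ler_sum => x _.
    rewrite -/(cellp x); set h := eta m _.
    have ux : 0 < u ^+ x.1 by exact: exprn_gt0.
    rewrite -subr_ge0; have -> : (B * u ^- x.1 + c ^+ 2 / B * (u ^+ x.1 * h ^+ 2)) / 2 - c * h =
        (B * u ^- x.1) / 2 * (1 - c * h * u ^+ x.1 / B) ^+ 2.
      by field; rewrite !gt_eqF.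
    by rewrite mulr_ge0 ?sqr_ge0// divr_ge0// divr_ge0// ltW.
  move=> h1; have h2 : c ^+ 2 / B * E2 <= c ^+ 2.
    by rewrite mulrAC ler_pdivrMr// ler_wpM2l// sqr_ge0.
  have h3 : c ^+ 2 <= c * (\sum_(x <- l) eta m (cellp x)) by rewrite expr2 ler_wpM2l// ltW.
  rewrite ler_pdivrMr// mulrC; lra.
have Sl : \sum_(x <- l) u ^- x.1 <= (3 ^ d)%:R * \sum_(i <- iota 0 m) u ^- (p i).2.
  have ui x : 0 <= u ^- x by rewrite invr_ge0 exprn_ge0// ltW.
  apply: (@le_trans _ _ (\sum_(x <- l0) u ^- x.1)).
    rewrite /l big_filter; apply: (@le_trans _ _ (\sum_(x <- undup l0) u ^- x.1)).
      by rewrite [leRHS](bigID (fun x => x.2 \in dyadic_keys x.1))/= lerDl sumr_ge0.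
    by apply: sum_undup_le => x; exact: ui.
  rewrite big_allpairs_dep mulr_sumr; apply: ler_sum => i _ /=.
  by rewrite big_const_seq count_predT size_neighbor_keys iter_addr_0 mulr_natl.
have d3 : 0 < (3 ^ d)%:R :> R by rewrite ltr0n expn_gt0.
apply: (@le_trans _ _ (\sum_(i <- iota 0 m) u ^- (p i).2)%:E).
  by rewrite lee_fin ler_pdivrMr// [leRHS]mulrC; exact: le_trans lS Sl.
rewrite -sumEFin.
apply: (@le_trans _ _ (\sum_(i <- iota 0 m) (hausdorff_gauge t (U i) + (e / 2 ^+ i.+1)%:E))%E).
  by apply: lee_sum => i _; have [_ _] := pP i.
rewrite big_split/= leeD//.
  have := @nneseries_lim_ge R (fun i => hausdorff_gauge t (U i)) xpredT 0 m.
  by rewrite /index_iota subn0; apply=> i _ _; exact: hausdorff_gauge_ge0.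
rewrite sumEFin lee_fin -mulr_sumr ler_piMr ?(ltW e0)//.
rewrite -[X in iota 0 X]subn0 big_mkord.
have := @geometric_sum_le _ (2^-1 : R) m ltac:(lra).
under [X in _ -> X <= _]eq_bigr do rewrite exprS invfM -exprVn.
have half : 1 - 2^-1 = 2^-1 :> R by lra.
by rewrite -mulr_sumr half invrK => h; rewrite mulrC ler_pdivrMr// mul1r.
Qed.

End content_lower_bound.

(** * Random coordinates and local dimension *)

Section coordinates.
Context {R : realType} {d : nat}.
Variable mu : probability (borelRV R d) R.
Variable P : probability (Omega_space mu) R.
Hypothesis PE : is_product_measure P.

Lemma measurable_Omega_coord n (A : set (borelRV R d)) : measurable A ->
  measurable ([set w | A (Omega_coord n w)] : set (Omega_space mu)).
Proof.
move=> mA; apply: sub_sigma_algebra; exists n => //; exists A => //.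
by rewrite setTI.
Qed.

Lemma Omega_coord_indep n n' (A B : set (borelRV R d)) : n != n' ->
  measurable A -> measurable B ->
  P [set w | A (Omega_coord n w) /\ B (Omega_coord n' w)] = (mu A * mu B)%E.
Proof.
move=> nn' mA mB; pose m := (maxn n n').+1.
have nm : (n < m)%N by rewrite ltnS leq_maxl.
have n'm : (n' < m)%N by rewrite ltnS leq_maxr.
pose E i := if i == n then A else if i == n' then B else setT.
have mE i : measurable (E i) by rewrite /E; do 2 case: ifP => // _.
have := @PE m E mE.
rewrite (bigD1 (Ordinal nm))//= (bigD1 (Ordinal n'm))/=; last first.
  by rewrite -val_eqE/= eq_sym.
rewrite big1 ?mule1; last first.
  move=> i; rewrite -!val_eqE/= => /andP[/negPf h1 /negPf h2].
  by rewrite /E h1 h2 probability_setT.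
have -> : E n = A by rewrite /E eqxx.
have -> : E n' = B by rewrite /E eq_sym (negPf nn') eqxx.
move=> <-; congr (P _); apply/seteqP; split => w /=.
  by move=> [Aw Bw] i _; rewrite /E; case: eqP => [->//|_]; case: eqP => [->//|].
move=> h; have := h n nm; have := h n' n'm.
by rewrite /E eqxx (eq_sym n' n) (negPf nn') eqxx.
Qed.

Lemma Omega_coord_law n (A : set (borelRV R d)) : measurable A ->
  P [set w | A (Omega_coord n w)] = mu A.
Proof.
move=> mA; have := @Omega_coord_indep n n.+1 A setT _ mA measurableT.
rewrite probability_setT mule1 => <-; last by rewrite neq_ltn ltnSn.
by congr (P _); apply/seteqP; split => w /= => [|[]].
Qed.

(** Every coordinate of a point of [Omega] lies in the support by construction, so the complement is
    the law of coordinate 0 evaluated on an empty event. *)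
Lemma mu_setC_spt : compact (spt mu) -> mu (~` spt mu) = 0%E.
Proof.
move=> cspt; have mS : measurable (~` spt mu : set (borelRV R d)).
  apply: sub_sigma_algebra; apply: closed_openC.
  by apply: compact_closed => //; exact: norm_hausdorff.
rewrite -(Omega_coord_law 0 mS) (_ : mkset _ = set0) ?measure0//.
apply/seteqP; split => // w /=; apply.
exact: set_mem (valP (w 0%N)).
Qed.

Lemma spt_Omega_coord n (w : Omega mu) : spt mu (Omega_coord n w).
Proof. exact: set_mem (valP (w n)). Qed.

End coordinates.

(** * Large local dimension yields a regular part of positive measure *)

Section regular_points.
Context {R : realType} {d : nat}.
Variable mu : probability (borelRV R d) R.
Variables (M t : R).
Hypothesis M0 : 0 < M.
Hypothesis sptM : forall x, spt mu x -> forall l, `|x ord0 l| < M.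
Hypothesis muC : mu (~` spt mu) = 0%E.
Hypothesis mspt : measurable (spt mu : set (borelRV R d)).

Let u : R := 2 `^ t.

Lemma ball_le_of_local_dim (x : 'rV[R]_d) : (t%:E < lower_local_dim mu x)%E ->
  exists2 rho, 0 < rho & forall r, 0 < r < rho -> fine (mu (eball x r)) <= r `^ t.
Proof.
rewrite /lower_local_dim limf_einfE => /ereal_sup_gt[_ [V V0 <-] tV].
have [rho /= rho0 Vrho] : \forall r \near 0^'+, V r := V0.
(* Radii below 1 make [ln r] negative, which reverses the inequality when the quotient is
   cleared. *)
exists (Num.min rho 1); first by rewrite lt_min rho0 ltr01.
move=> r /andP[r0]; rewrite lt_min => /andP[rrho r1].
have Vr : V r.
  by apply: Vrho => //=; rewrite /ball_/= sub0r normrN gtr0_norm.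
have : (t%:E < lne (mu (eball x r)) / (ln r)%:E)%E.
  by apply: (lt_le_trans tV); apply: ereal_inf_lbound; exists r.
have lnr : ln r < 0 by rewrite ln_lt0// r0.
have mb : measurable (eball x r : set (borelRV R d)).
  by apply: sub_sigma_algebra; exact: eball_open.
rewrite -[mu _]fineK ?fin_num_measure//.
have : 0 <= fine (mu (eball x r)) by rewrite fine_ge0.
move: (fine _) => y y0; have [->|yn0] := eqVneq y 0; first by rewrite powR_ge0.
have {}y0 : 0 < y by rewrite lt_neqAle eq_sym yn0.
rewrite lne_EFin// inver (lt_eqF lnr) -EFinM lte_fin ltr_ndivlMr//.
move=> h; rewrite -ler_ln ?posrE ?powR_gt0// ln_powR.
exact: ltW.
Qed.

(** At fine levels the cell of [x] lies, up to a null set, in a ball of comparable radius about [x];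
    the finitely many coarse levels are absorbed into the constant. *)
Lemma regular_of_local_dim (x : 'rV[R]_d) : spt mu x ->
  (t%:E < lower_local_dim mu x)%E ->
  exists n : nat, regular_part mu u (dyadic_key M) n%:R x.
Proof.
move=> Sx /ball_le_of_local_dim[rho rho0 rhoP].
have fm := fcontent_fine mu.
have u0 : 0 < u by exact: powR_gt0.
(* [C / 2 ^+ i] is twice the distance bound of [same_key_close], leaving room for an open ball. *)
pose C : R := d.+1%:R * (2 * (2 * M)).
have C0 : 0 < C by rewrite !mulr_gt0.
have [i0 i0P] := @expr_inv_small _ 2 (rho / C) ltac:(by rewrite ltr1n) (divr_gt0 rho0 C0).
have mcell i (k : {ffun 'I_d -> nat}) : measurable (cell (dyadic_key M) i k).
  exact: measurable_dyadic_cell.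
have bound i : u ^+ i * fine (mu (cell (dyadic_key M) i (dyadic_key M i x))) <=
    Num.max (\sum_(j < i0) u ^+ j) (C `^ t).
  rewrite le_max; have [ii0|i0i] := ltnP i i0.
    apply/orP; left; rewrite (bigD1 (Ordinal ii0))//=.
    apply: (@le_trans _ _ (u ^+ i)); last first.
      by rewrite lerDl sumr_ge0// => j _; rewrite exprn_ge0// ltW.
    rewrite ler_piMr ?exprn_ge0 ?(ltW u0)//.
    have mx := mcell i (dyadic_key M i x).
    by rewrite -lee_fin fineK ?fin_num_measure//; exact: probability_le1.
  apply/orP; right; pose r := C / 2 ^+ i.
  have r0 : 0 < r by rewrite divr_gt0// exprn_gt0.
  have rr : 0 < r < rho.
    by rewrite r0/= /r mulrC -ltr_pdivlMr// i0P.
  have rt : r `^ t = C `^ t / u ^+ i.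
    rewrite /r powRM ?(ltW C0) ?invr_ge0 ?exprn_ge0//; congr (_ * _).
    by rewrite -[2 ^- i](@powR_invn _ 2 i)// -powRrM mulrC powRrM powR_invn ?(ltW u0).
  rewrite mulrC -ler_pdivlMr ?exprn_gt0// -rt; apply: le_trans (rhoP _ rr).
  (* Only the part of the cell inside the support is near [x], since coordinates outside the range
     are also rescaled to 0. *)
  rewrite (fcontent_split fm (mcell i _) mspt) addrC.
  have -> : fine (mu (cell (dyadic_key M) i (dyadic_key M i x) `\` spt mu)) = 0.
    apply/eqP; rewrite eq_le fine_ge0// andbT -[leRHS]/(fine 0%E) -muC.
    apply: (fcontent_le fm); [exact: measurableD|exact: measurableC|by move=> y []].
  rewrite add0r; apply: (fcontent_le fm); first exact: measurableI.
    by apply: sub_sigma_algebra; exact: eball_open.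
  move=> y [Sy yx]; rewrite /eball /=.
  apply: le_lt_trans (same_key_close M0 (sptM Sx) (sptM Sy) (esym yx)) _.
  rewrite /r /C /side -!mulrA ltr_pM2l// mulrA [ltRHS]mulrC.
  by rewrite ltr_pMr ?ltr1n// divr_gt0 ?exprn_gt0// mulr_gt0.
exists (Num.truncn (Num.max (\sum_(j < i0) u ^+ j) (C `^ t))).+1 => i.
by apply: (le_trans (bound i)); rewrite ltW// truncnS_gt.
Qed.

(** If every regular part were null, the lower local dimension would be at most [t] almost
    everywhere, and so would its essential supremum. *)
Lemma regular_part_positive : (t%:E < upper_hausdorff_dim mu)%E ->
  exists C : R, 0 < fine (mu (regular_part mu u (dyadic_key M) C)).
Proof.
move=> tdim; apply: contrapT => /forallNP nC.
have mcell i (k : {ffun 'I_d -> nat}) : measurable (cell (dyadic_key M) i k).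
  exact: measurable_dyadic_cell.
have mR C : measurable (regular_part mu u (dyadic_key M) C).
  exact: measurable_regular_part.
move: tdim; apply/negP; rewrite -leNgt; apply: ereal_inf_lbound => /=.
have neg : mu.-negligible (~` spt mu `|`
    \bigcup_n regular_part mu u (dyadic_key M) n%:R : set (borelRV R d)).
  apply: negligibleU; first by exists (~` spt mu); split => //; exact: measurableC.
  apply: negligible_bigcup => n; apply/negligibleP => //.
  have := nC n%:R; move=> /negP; rewrite -leNgt => mu0.
  apply/eqP; rewrite eq_le measure_ge0 andbT.
  by rewrite -(fineK (fin_num_measure mu _ (mR n%:R))) lee_fin.
apply: negligibleS neg => x /= /negP; rewrite -ltNge => tx.
have [Sx|nSx] := pselect (spt mu x); last by left.
by right; have [n nx] := regular_of_local_dim Sx tx; exists n.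
Qed.

End regular_points.

(** * The construction *)

Section blocks.
Context {R : realType}.
Variable v : R.
Hypothesis v_gt1 : 1 < v.

Let v0 : 0 < v. Proof. exact: lt_trans ltr01 v_gt1. Qed.

Definition block_size (j : nat) : nat := (Num.truncn (v ^+ j)).+1.

Definition block_start (j : nat) : nat := \sum_(i < j) block_size i.

Lemma expr_le_block_size j : v ^+ j <= (block_size j)%:R.
Proof. by rewrite ltW// truncnS_gt. Qed.

Lemma block_startS j : block_start j.+1 = (block_start j + block_size j)%N.
Proof. by rewrite /block_start big_ord_recr. Qed.

Lemma leq_block_start j j' : (j <= j')%N -> (block_start j <= block_start j')%N.
Proof.
move=> /subnKC <-; elim: (j' - j)%N => [|n ih]; first by rewrite addn0.
by rewrite addnS block_startS (leq_trans ih)// leq_addr.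
Qed.

Lemma leq_id_block_start j : (j <= block_start j)%N.
Proof.
elim: j => // j ih; rewrite block_startS /block_size addnS ltnS.
by rewrite (leq_trans ih)// leq_addr.
Qed.

(** Blocks occupy disjoint ranges of coordinates, so distinct block indices give independent random
    points. *)
Lemma block_index_inj j i j' i' : (i < block_size j)%N -> (i' < block_size j')%N ->
  (block_start j + i = block_start j' + i')%N -> (j, i) = (j', i').
Proof.
have lt a b x y : (a < b)%N -> (x < block_size a)%N ->
    (block_start a + x < block_start b + y)%N.
  move=> ab xa; apply: (@leq_trans (block_start a.+1)).
    by rewrite block_startS ltn_add2l.
  by rewrite (leq_trans (leq_block_start ab))// leq_addr.
move=> ij ij' E; case: (ltngtP j j') => [jj|jj|jj].
- by have := lt _ _ _ i' jj ij; rewrite E ltnn.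
- by have := lt _ _ _ i jj ij'; rewrite E ltnn.
- by move: E; rewrite jj => /addnI ->.
Qed.

Lemma block_start_le j : (block_start j.+1)%:R <= 2 * (v / (v - 1)) * v ^+ j.
Proof.
rewrite /block_start natr_sum -mulrA; apply: (@le_trans _ _ (2 * \sum_(i < j.+1) v ^+ i)).
  rewrite mulr_sumr; apply: ler_sum => i _.
  rewrite /block_size -natr1.
  have vi : 1 <= v ^+ i by rewrite exprn_ege1// ltW.
  have : (Num.truncn (v ^+ i))%:R <= v ^+ i by rewrite truncn_le// exprn_ge0// ltW.
  lra.
by rewrite ler_wpM2l//; exact: geometric_sum_ge1_le.
Qed.

(** Indices in block [j] are at most a constant times [v ^+ j], so the radii are at least a constant
    times [(v ^ alpha) ^- j]; this beats [2 ^- j] because [v ^ alpha < 2]. *)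
Lemma block_radius (alpha D : R) : 0 < alpha -> 0 < D -> v `^ alpha < 2 ->
  exists J, forall j i, (J <= j)%N -> (i < block_size j)%N ->
    D / 2 ^+ j < (block_start j + i).+1%:R `^ (- alpha).
Proof.
move=> alpha0 D0 va2.
pose C := 2 * (v / (v - 1)); have C0 : 0 < C.
  by rewrite mulr_gt0// divr_gt0// subr_gt0.
have va0 : 0 < v `^ alpha by exact: powR_gt0.
have [||J JP] := @expr_inv_small _ (2 / v `^ alpha) ((C `^ alpha)^-1 / D).
- by rewrite ltr_pdivlMr// mul1r.
- by rewrite divr_gt0// invr_gt0 powR_gt0.
exists J => j i Jj ij.
apply: (@lt_le_trans _ _ ((C * v ^+ j) `^ (- alpha))).
  rewrite powRN powRM ?(ltW C0) ?exprn_ge0 ?(ltW v0)//.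
  have -> : (v ^+ j) `^ alpha = (v `^ alpha) ^+ j.
    by rewrite -[v ^+ j]powR_mulrn ?(ltW v0)// powRAC powR_mulrn ?(ltW va0).
  have := JP _ Jj; rewrite ltr_pdivlMr// expr_div_n => h.
  apply: (le_lt_trans (y := (2 ^+ j / (v `^ alpha) ^+ j)^-1 * D / (v `^ alpha) ^+ j)).
    by rewrite le_eqVlt; apply/orP; left; apply/eqP; field; rewrite !expf_neq0// gt_eqF.
  by rewrite [ltRHS]invfM ltr_pM2r ?invr_gt0 ?exprn_gt0.
have p1 : 0 < C * v ^+ j by rewrite mulr_gt0// exprn_gt0.
have p2 : 0 < (block_start j + i).+1%:R :> R by rewrite ltr0n.
rewrite !powRN lef_pV2 ?posrE ?powR_gt0//.
apply: ge0_ler_powR; rewrite ?nnegrE ?(ltW alpha0) ?(ltW p1) ?(ltW p2)//.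
apply: le_trans (block_start_le j).
by rewrite ler_nat block_startS -addnS leq_add2l.
Qed.

End blocks.

(** * Assembly of the stages for a fixed exponent below [alpha^-1] *)

Section lower_bound.
Context {R : realType} {d : nat}.
Variable mu : probability (borelRV R d) R.
Variable P : probability (Omega_space mu) R.
Variable alpha : R.
Hypotheses (cmu : compact (spt mu)) (PE : is_product_measure P) (alpha0 : 0 < alpha).

Lemma spt_bounded : exists2 M : R, 1 <= M &
  forall x, spt mu x -> forall l, `|x ord0 l| < M.
Proof.
have [A [_ AP]] := compact_bounded cmu.
exists (Num.max 1 (A + 1) + 1); first by rewrite lerDr le_max ler01.
move=> x Sx l; apply: le_lt_trans (_ : `|x| < _).
  by rewrite [leRHS]/Num.Def.normr/= mx_normrE; apply: (le_bigmax _ (fun ij => `|x ij.1 ij.2|) (ord0, l)).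
rewrite ltr_pwDr//; apply: le_trans (AP (A + 1) _ x Sx) _; first by rewrite ltrDl.
by rewrite le_max lexx orbT.
Qed.


Variables (M t : R).
Hypotheses (M1 : 1 <= M) (sptM : forall x, spt mu x -> forall l, `|x ord0 l| < M).
Hypotheses (t0 : 0 < t) (talpha : t < alpha^-1).
Hypothesis alpha_dim : ((alpha^-1)%:E <= upper_hausdorff_dim mu)%E.

Let M0 : 0 < M. Proof. exact: lt_le_trans ltr01 M1. Qed.
(** Thirds of the gap: [t < t1] gives the decay of the deviation, [t1 < t2] the existence of good
    levels, and [t2 < alpha^-1] both a regular part of positive measure and balls larger than the
    cubes. *)
Let t1 : R := t + (alpha^-1 - t) / 3.
Let t2 : R := t + 2 * (alpha^-1 - t) / 3.
Let u : R := 2 `^ t.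
Let u1 : R := 2 `^ t1.
Let u2 : R := 2 `^ t2.

Let tt1 : t < t1. Proof. by rewrite /t1; move: talpha; lra. Qed.
Let t12 : t1 < t2. Proof. by rewrite /t1 /t2; move: talpha; lra. Qed.
Let t2a : t2 < alpha^-1. Proof. by rewrite /t2; move: talpha; lra. Qed.

Let powR2_lt (a b : R) : 0 < a -> a < b -> 2 `^ a < 2 `^ b.
Proof.
move=> a0 ab; rewrite /powR pnatr_eq0/= ltr_expR ltr_pM2r// ln_gt0// ltr1n//.
Qed.

Let u_gt1 : 1 < u. Proof. exact: powR2_gt1. Qed.
Let uu1 : u < u1. Proof. exact: powR2_lt. Qed.
Let u12 : u1 < u2. Proof. apply: powR2_lt => //; exact: lt_trans tt1. Qed.

Local Notation key := (dyadic_key (d := d) M).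
Local Notation keys := (dyadic_keys (d := d)).
Local Notation N := (block_size u1).

Let Wc (j i : nat) (w : Omega_space mu) : borelRV R d :=
  Omega_coord (block_start u1 j + i) w.

Let mcell i (k : {ffun 'I_d -> nat}) : measurable (cell key i k).
Proof. exact: measurable_dyadic_cell. Qed.

Let closed_spt : closed (spt mu).
Proof. by apply: compact_closed => //; exact: norm_hausdorff. Qed.

Let mspt : measurable (spt mu : set (borelRV R d)).
Proof.
rewrite -[spt mu]setCK; apply: measurableC; apply: sub_sigma_algebra.
exact: closed_openC.
Qed.

(** Each closed ball contains the points of the support that share the cube of its centre. Closed
    balls replace the half-open cubes so that the intersections over stages stay compact. *)
Definition hit_set j0 j1 (w : Omega_space mu) : set 'rV[R]_d :=
  \bigcup_(p in [set` block_indices N j0 j1])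
    closed_eball (Wc p.1 p.2 w) (d.+1%:R * side M p.1).

Lemma closed_hit_set j0 j1 w : closed (hit_set j0 j1 w).
Proof.
apply: closed_bigcup; first exact: finite_seq.
by move=> p _; exact: closed_closed_eball.
Qed.

Lemma hit_set_sub : exists J, forall j0 j1 n w, (J <= j0)%N -> (n <= j0)%N ->
  hit_set j0 j1 w `<=`
    \bigcup_(k in [set k | (n <= k)%N]) eball (Omega_coord k w) (k.+1%:R `^ (- alpha)).
Proof.
have u1_gt1 : 1 < u1 := lt_trans u_gt1 uu1.
have [||J JP] := @block_radius _ u1 u1_gt1 alpha (d.+1%:R * (2 * M)) alpha0.
- by rewrite !mulr_gt0.
(* [u1 ^ alpha] is 2 to the power [t1 * alpha], which is less than 1. *)
- rewrite -powRrM -[ltRHS]powRr1//; apply: powR2_lt.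
    by rewrite mulr_gt0//; exact: lt_trans tt1.
  by rewrite -ltr_pdivlMr// mul1r; exact: lt_trans t2a.
exists J => j0 j1 n w Jj0 nj0 x [p /= /allpairsPdep[j [i [jj ii ->]]]]/= xp.
move: jj ii; rewrite mem_index_iota mem_iota /= add0n => /andP[j0j _] ij.
exists (block_start u1 j + i)%N => /=.
  rewrite (leq_trans nj0)// (leq_trans j0j)// (leq_trans (leq_id_block_start u1 j))//.
  exact: leq_addr.
apply: (le_lt_trans xp); rewrite /side mulrA.
by apply: JP => //; exact: leq_trans j0j.
Qed.

(** Probability enters only through one almost sure statement about the countably many codes; for a
    fixed [w] the stages are then chosen by a deterministic recursion. *)
Lemma covering_content : {ae P, forall w, exists2 c : R, 0 < c &
  forall U : nat -> set 'rV[R]_d, covering_set alpha w `<=` \bigcup_i U i ->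
    (forall i, ediam (U i) <= 1)%E ->
    (c%:E <= \sum_(i <oo) hausdorff_gauge t (U i))%E}.
Proof.
have dim2 : (t2%:E < upper_hausdorff_dim mu)%E.
  by apply: lt_le_trans alpha_dim; rewrite lte_fin.
have [C C0] := regular_part_positive M0 sptM (mu_setC_spt PE cmu) mspt dim2.
pose A := regular_part mu u2 key C; have mA : measurable A.
  exact: measurable_regular_part.
pose nu E := fine (mu (A `&` E)).
have fm := fcontent_fine mu.
have fnu : fcontent nu := fcontent_restr fm mA.
have num E : measurable E -> nu E <= fine (mu E).
  by move=> mE; apply: (fcontent_le fm) => //; exact: measurableI.
pose content c := coded_content mu u1 key N nu c.
have contentP c := coded_contentP mu u1 N mcell fnu c.
(* One more than the energy bound of the initial content, which makes the initial inequality
   strict. *)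
pose B : R := `|C| * (1 - u / u2)^-1 + 1.
have u10 : 0 < u1 := lt_trans (lt_trans ltr01 u_gt1) uu1.
have energy_nu L := @energy_regular_part _ _ _ _ mu u2 key keys (@uniq_dyadic_keys d)
  (mem_dyadic_keys M0) mcell u C L (lt_trans ltr01 u_gt1) (lt_trans uu1 u12).
have B0 : 0 < B by rewrite /B ltr_pwDr//; move: (energy_nu 0%N); rewrite /energy big_ord0.
pose m0 := nu setT / 2.
have nuT : 0 < nu setT by rewrite /nu setIT.
have m00 : 0 < m0 by rewrite divr_gt0.
pose ok c := energy_mass_ok u key keys B m0 (content c).
have ok0 : ok [::].
  split; last by rewrite /m0 /content /=; lra.
  exists (B - 1); first by rewrite ltrBlDr ltrDl.
  by move=> L; rewrite /B addrK; exact: energy_nu.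
have sel j0 (e : R) : 0 < e ->
    exists2 j1, (j0 <= j1)%N & nu (~` selected mu u1 key j0 j1) < e.
  move=> e0; exact: (selected_exhausts mu (@uniq_dyadic_keys d) (mem_dyadic_keys M0)
    mcell u10 u12 C j0 e0).
have step c J0 : ok c -> {ae P, forall w, exists j0 j1, (J0 <= j0)%N /\
    ok ((j0, observation key N Wc j0 j1 w) :: c)}.
  move=> okc; have [fc [H H0 cH]] := contentP c.
  apply: (@refine_ok _ _ _ _ mu u u1 u1 key keys N (@uniq_dyadic_keys d)
    (mem_dyadic_keys M0) mcell u_gt1 uu1 uu1 (expr_le_block_size u1)
    [ffun=> 0%N] (dyadic_key0 M0) (mem_dyadic_keys0 M0) _ _ P Wc _ _ _ nu _ H) => //.
  - by move=> j i E mE; exact: measurable_Omega_coord.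
  - by move=> j i E mE; exact: Omega_coord_law.
  - move=> j i j' i' E F ji ij ij' mE mF; apply: Omega_coord_indep => //.
    by apply: contraNneq ji => /(block_index_inj ij ij') ->.
have [J JP] := hit_set_sub.
have : {ae P, forall w, forall x : seq (nat * seq (nat * {ffun 'I_d -> nat})) * nat,
    ok x.1 -> exists j0 j1, (x.2 <= j0)%N /\
    ok ((j0, observation key N Wc j0 j1 w) :: x.1)}.
  apply: ae_forall_countable => -[c J0] /=.
  have [okc|nokc] := pselect (ok c); last by apply: aeW.
  by apply: filterS (step c J0 okc) => w.
apply: filterS => w wP.
have /choice[f fP] : forall x : seq (nat * seq (nat * {ffun 'I_d -> nat})) * nat,
    exists jj : nat * nat, ok x.1 -> (x.2 <= jj.1)%N /\
    ok ((jj.1, observation key N Wc jj.1 jj.2 w) :: x.1).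
  move=> x; have [okx|nokx] := pselect (ok x.1); last by exists (0, 0)%N.
  by have [j0 [j1 h]] := wP x okx; exists (j0, j1).
(* Starting at level [J + n] or later puts the hit set inside the random balls of index at least
   [n]; a point of all [K n] is therefore in infinitely many balls. *)
pose next n c := (f (c, (J + n)%N)).
pose code := fix code n := if n is n'.+1 then
  let jj := next n' (code n') in
  (jj.1, observation key N Wc jj.1 jj.2 w) :: code n' else [::].
pose K := fix K n := if n is n'.+1 then
  let jj := next n' (code n') in K n' `&` hit_set jj.1 jj.2 w else spt mu.
have okcode n : ok (code n).
  by elim: n => // n ih /=; have [] := fP (code n, (J + n)%N) ih.
have clK n : closed (K n).
  elim: n => [//|n ih] /=; apply: closedI => //; exact: closed_hit_set.
have Kspt n : K n `<=` spt mu by elim: n => // n ih x [/ih].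
have mK n : measurable (~` K n : set (borelRV R d)).
  by apply: sub_sigma_algebra; exact: closed_openC.
have contentK n : content (code n) (~` K n) = 0.
  elim: n => [|n ih].
    apply/eqP; rewrite eq_le (fcontent_ge0 fnu) ?andbT//.
    apply: (le_trans (num _ (mK 0%N))).
    by have := mu_setC_spt PE cmu => /= ->.
  rewrite /content /= /refine big_map big_seq big1// => p pl /=.
  set E := (X in _ * _ X).
  have [fc _] := contentP (code n).
  suff E0 : content (code n) E = 0 by rewrite [X in _ * X]E0 mulr0.
  have mE : measurable E.
    by apply: measurableI; [exact: measurable_piece|exact: (mK n.+1)].
  apply/eqP; rewrite eq_le (fcontent_ge0 fc)// andbT -[leRHS]ih.
  (* A point of [K n] in an observed piece shares its cube with a random point, hence lies in the
     ball around it and in [K n.+1]. *)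
  apply: (fcontent_le fc) => // x [[_ xp] nK] Kx; apply: nK; split => //.
  exists p => //; apply: (same_key_close M0).
  - exact: (sptM (spt_Omega_coord _ w)).
  - exact: (sptM (Kspt _ _ Kx)).
  - exact: esym xp.
exists (m0 ^+ 2 / B / (3 ^ d)%:R).
  by rewrite !divr_gt0// ?exprn_gt0// ltr0n expn_gt0.
move=> U EU U1; apply: (content_lower_bound M1 t0 cmu (spt_nonempty mu) sptM Kspt clK
  (eta := fun n => content (code n))) => //.
- by move=> n x [].
- by move=> n; exact: (contentP (code n)).1.
- move=> n L; have [[b bB bL] _] := okcode n; exact: le_trans (bL L) (ltW bB).
- by move=> n; have [] := okcode n.
apply: subset_trans EU => x Kx n _.
have [_ hx] := Kx n.+1 I.
have [jn _] := fP (code n, (J + n)%N) (okcode n).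
apply: (JP _ _ n w _ _ _ hx).
- exact: leq_trans (leq_addr _ _) jn.
- exact: leq_trans (leq_addl _ _) jn.
Qed.

End lower_bound.

Theorem theorem2p3 (R : realType) (d : nat) (mu : probability (borelRV R d) R)
    (P : probability (Omega_space mu) R) (alpha : R)
    (cmu : compact (spt mu)) (PE : is_product_measure P) (alpha0 : 0 < alpha)
    (alpha_dim : ((alpha^-1)%:E <= upper_hausdorff_dim mu)%E) :
  {ae P, forall w, hausdorff_dim (covering_set alpha w) = (alpha^-1)%:E}.
Proof.
have a0 : 0 < alpha^-1 by rewrite invr_gt0.
have [M M1 sptM] := spt_bounded cmu.
(* Exponents tending to [alpha^-1] from below; as they are countably many, one null set serves all
   of them. *)
pose t n : R := alpha^-1 * (1 - n.+2%:R^-1).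
have n2 n : 0 < (n.+2%:R^-1 : R) < 1 by rewrite invr_gt0 invf_lt1 ?ltr0n// ltr1n.
have t0 n : 0 < t n by rewrite mulr_gt0// subr_gt0; case/andP: (n2 n).
have ta n : t n < alpha^-1 by rewrite gtr_pMr// gtrBl; case/andP: (n2 n).
have := ae_forall_countable (fun n => covering_content cmu PE alpha0 M1 sptM (t0 n) (ta n) alpha_dim).
apply: filterS => w wP; apply/eqP; rewrite eq_le; apply/andP; split.
  exact: hausdorff_dim_limsup_balls_le.
apply: hausdorff_dim_ge => s /andP[s0 sa].
have [n st] : exists n, s <= t n.
  have e0 : 0 < (alpha^-1 - s) * alpha by rewrite mulr_gt0// subr_gt0.
  exists (Num.truncn ((alpha^-1 - s) * alpha)^-1); set n := Num.truncn _.
  rewrite /t mulrBr mulr1 lerBrDr -lerBrDl ler_pdivrMl//.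
  rewrite -[leRHS]invrK mulrC lef_pV2 ?posrE ?invr_gt0// ?ltr0n//.
  by rewrite ltW// (lt_trans (truncnS_gt _))// ltr_nat.
have [c c0 cover] := wP n.
by apply: hausdorff_measure_neq0 c0 cover; rewrite s0.
Qed.
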